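(* Let $d\in\mathbb{N}$ and $k\in\{0,\dots,d\}$. Then: (i) if $d\ge2$, the limits $a(1,d)$ and $a(d-1,d)$ exist and $a(1,d)=a(d-1,d)=0$; (ii) if $d\ge2$ and $0<k<d$, the limit $b(k,d)$ exists and $b(k,d)=d(d+1)$; (iii) if $d$ is prime and $0<k<d$, the limit $a(k,d)$ exists and $a(k,d)=0$.
   Context: For algebraic $\alpha$ of degree $d$, with $a_0>0$ the leading coefficient of a minimal polynomial of $\alpha$ in $\mathbb{Z}[t]$ and conjugates $\alpha_1,\dots,\alpha_d$, $H(\alpha)=\big(a_0\prod_i\max\{1,|\alpha_i|\}\big)^{1/d}$ (absolute multiplicative Weil height). For $\mathcal{H}\ge1$: $A(k,d,\mathcal{H})=\{\alpha\in\mathbb{C}: [\mathbb{Q}(\alpha):\mathbb{Q}]=d,\ H(\alpha)=\mathcal{H},$ precisely $k$ conjugates of $\alpha$ in the open unit disk$\}$; $A(k,d)=\bigcup_{\mathcal{H}\ge1}A(k,d,\mathcal{H})$; $B(k,d)=\{H(\alpha):\alpha\in A(k,d)\}$; $B(k,d,\mathcal{H})=B(k,d)\cap[1,\mathcal{H}]$. $a(k,d)=\lim_{\mathcal{H}\in B(k,d),\mathcal{H}\to\infty}\log|A(k,d,\mathcal{H})|/\log\mathcal{H}$ and $b(k,d)=\lim_{\mathcal{H}\to\infty}\log|B(k,d,\mathcal{H})|/\log\mathcal{H}$, when these limits exist. *)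

(* Defs.v *)
From HB Require Import structures.
From mathcomp Require Import all_boot all_order all_algebra all_field.
From mathcomp Require Import finmap.
From mathcomp Require Import all_classical all_reals all_analysis.
Unset Printing Implicit Defensive.
Import Order.TTheory GRing.Theory Num.Theory.
Local Open Scope ring_scope.
Local Open Scope classical_set_scope.

Definition minQpoly (a : algC) : {poly rat} := sval (minCpolyP a).

Definition degA (a : algC) : nat := (size (minCpoly a)).-1.

(* the minimal polynomial of a in Z[t] (primitive, positive leading coeff):
   clear denominators of minQpoly a, then take the primitive part *)
Definition denomA (a : algC) : int := \prod_(c <- minQpoly a) (denq c).
Definition minZpoly (a : algC) : {poly int} :=
  zprimitive (\poly_(i < size (minQpoly a))
                 numq ((minQpoly a)`_i * (denomA a)%:~R)).
Definition lead0 (a : algC) : int := lead_coef (minZpoly a).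

(* the conjugates alpha_1, ..., alpha_d of a (roots of its minimal polynomial,
   listed with multiplicity; minCpoly a is monic so lead_coef = 1) *)
Definition conjs (a : algC) : seq algC := sval (closed_field_poly_normal (minCpoly a)).

Definition mahler (a : algC) : algC :=
  (lead0 a)%:~R * \prod_(r <- conjs a) Num.max 1 `|r|.

(* embedding of (real) algebraic numbers into the reals R: x |-> sup{q in Q | q <= x} *)
Definition toR (R : realType) (x : algC) : R :=
  sup [set (ratr q : R) | q in [set q : rat | ratr q <= x]].

Definition height (R : realType) (a : algC) : R :=
  powR (toR R (mahler a)) ((degA a)%:R^-1).

Definition n_in_disk (a : algC) : nat := count (fun r => `|r| < 1) (conjs a).

Definition Aset (R : realType) (k d : nat) (H : R) : set algC :=
  [set a | degA a = d /\ height R a = H /\ n_in_disk a = k].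
Definition Aall (R : realType) (k d : nat) : set algC :=
  [set a | exists H : R, 1 <= H /\ Aset R k d H a].
Definition Bset (R : realType) (k d : nat) : set R := height R @` Aall R k d.
Definition Bupto (R : realType) (k d : nat) (H : R) : set R :=
  Bset R k d `&` [set x | 1 <= x <= H].

Definition card_set (T : choiceType) (A : set T) : nat := #|` fset_set A|%fset.

Definition lim_infty_on (R : realType) (S : set R) (f : R -> R) (L : R) : Prop :=
  (forall M : R, exists x, S x /\ M < x) /\
  (forall e : R, 0 < e -> exists M : R, forall x, S x -> M < x -> `|f x - L| < e).

Definition a_lim (R : realType) (k d : nat) (L : R) : Prop :=
  lim_infty_on R (Bset R k d)
    (fun H => ln ((card_set _ (Aset R k d H))%:R) / ln H) L.

Definition b_lim (R : realType) (k d : nat) (L : R) : Prop :=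
  lim_infty_on R [set: R]
    (fun H => ln ((card_set _ (Bupto R k d H))%:R) / ln H) L.

(* Main.v *)
Require Import Defs.
From HB Require Import structures.
From mathcomp Require Import all_boot all_order all_algebra all_field all_fingroup all_solvable.
From mathcomp Require Import all_classical all_reals all_analysis.
From mathcomp Require Import ring lra zify.
Import Order.TTheory GRing.Theory Num.Theory.
Set Implicit Arguments.
Unset Strict Implicit.
Unset Printing Implicit Defensive.
Local Open Scope ring_scope.

(* Let S be the set of indices of the conjugates of alpha outside the open unit
   disk and a0 its leading coefficient. Then M = H(alpha)^d equals, up to sign,
   a0 * \prod_(i in S) alpha_i, and its conjugates are the products over the
   translates of S by the Galois group G of alpha. If the indicator functions of
   these translates span Q^d, then a bounded power of alpha is a monomial in the
   conjugates of M and in a0. Moreover a0 divides an integer which is at most a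
   fixed power of M, so by the divisor bound M determines alpha up to M^{o(1)}
   choices. The spanning condition holds
   - if |S| = 1 or |S| = d - 1, by transitivity of G;
   - if d is prime: G contains a d-cycle, with permutation matrix T, and
     F(T)^d = |S| mod d for the polynomial F such that F(T) is the sum over S;
   - if some element of G fixes one point and is transitive on the others.
   This gives (i) and (iii). For (ii), the upper bound counts minimal
   polynomials with coefficients at most 2^d H^d. For the lower bound, take
   integer polynomials with coefficients in boxes of side N, congruent to an
   irreducible polynomial mod 2 and to X times an irreducible polynomial mod 3:
   Frobenius elements at 2 and 3 put G in the third case. Making the k-th
   coefficient dominant puts exactly k roots in the unit disk. There are N^(d+1)
   such polynomials, each height O(N^(1/d)) is shared by N^{o(1)} of them, and
   N is about H^d. *)

(** * Conjugates and the Galois action *)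

(** The roots of [minCpoly x] generate a number field [L] that is a splitting field, hence normal
    over Q. So an element of its Galois group sends [x] to [y], and it extends to all algebraic
    numbers. *)
Lemma algC_conj_aut (x y : algC) : root (minCpoly x) y ->
  exists nu : {rmorphism algC -> algC}, nu x = y.
Proof.
have [rs Drs] := closed_field_poly_normal (minCpoly x).
have [p [Dp p_mon] minp] := minCpolyP x.
have [L [LC [s1 Ds genL]]] := num_field_exists rs.
move: Drs; rewrite (monicP (minCpoly_monic x)) scale1r => Drs yroot.
have mapLC (q : {poly rat}) : map_poly LC (map_poly (in_alg L) q) = map_poly ratr q.
  by rewrite -map_poly_comp; apply: eq_map_poly => a /=; rewrite alg_num_field fmorph_rat.
have Ep : map_poly (in_alg L) p = \prod_(z <- s1) ('X - z%:P).
  apply: (map_poly_inj LC); rewrite mapLC -Dp Drs -Ds rmorph_prod big_map.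
  by apply: eq_bigr => z _; rewrite rmorphB /= map_polyX map_polyC.
have splitp : splittingFieldFor 1 (map_poly (in_alg L) p) {:L}.
  by exists s1 => //; rewrite Ep eqpxx.
have rq (q : {poly rat}) (z : L) : y = LC z -> p %| q -> root (map_poly (in_alg L) q) z.
  move=> Dy /dvdpP[u ->]; rewrite -(fmorph_root LC) mapLC -Dy rmorphM rootM.
  by apply/orP; right; move: yroot; rewrite Dp.
have p1 : map_poly (in_alg L) p \is a polyOver 1%VS.
  by apply/polyOver1P; exists p.
have L_ax : FieldExt_isSplittingField _ L by constructor; exists (map_poly (in_alg L) p).
pose Ls : splittingFieldType rat := HB.pack_for (splittingFieldType rat) L L_ax.
have inrs z : root (minCpoly x) z -> exists2 z1 : L, z1 \in s1 & z = LC z1.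
  by rewrite Drs root_prod_XsubC -Ds => /mapP[z1]; exists z1.
have [x1 x1s Dx] := inrs _ (root_minCpoly x).
have [y1 y1s Dy] := inrs _ yroot.
have rxy : root (minPoly (L:=Ls) 1%AS x1) (y1 : Ls).
  have /polyOver1P[q Dq] := minPolyOver (L := Ls) 1%AS x1.
  have := root_minPoly (L := Ls) 1%AS x1; rewrite Dq.
  rewrite -(fmorph_root LC) mapLC -Dx minp => pq.
  exact: rq.
have [g _ gx] := normalField_root_minPoly (subvf (1%AS : {subfield Ls})) (normalFieldf _) (memvf (x1 : Ls)) rxy.
have [nu nuE] := extend_algC_subfield_aut LC (gal_repr g).
by exists nu; rewrite Dx Dy -gx; exact: (esym (nuE x1)).
Qed.

(** All n roots of the minimal polynomial equal [x], so its second coefficient is - n x. This is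
    rational, and n is invertible. *)
Lemma fixed_Crat (x : algC) :
  (forall nu : {rmorphism algC -> algC}, nu x = x) -> x \in Crat.
Proof.
move=> fx; have [rs Drs] := closed_field_poly_normal (minCpoly x).
move: Drs; rewrite (monicP (minCpoly_monic x)) scale1r => Drs.
have rsx z : z \in rs -> z = x.
  rewrite -root_prod_XsubC -Drs => /algC_conj_aut[nu <-]; exact: fx.
have := size_minCpoly x; rewrite Drs size_prod_XsubC ltnS => rs0.
have := coefPn_prod_XsubC (lt0n_neq0 rs0); rewrite -Drs.
rewrite big_seq (eq_bigr (fun=> x)); last by move=> z /rsx.
rewrite -big_seq big_const_seq count_predT iter_addr_0 => xE.
have [p [Dp _] _] := minCpolyP x.
have : x *+ size rs \in Crat.
  by rewrite -rpredN -xE Dp coef_map Crat_rat.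
move=> nx; suff -> : x = x *+ size rs / (size rs)%:R by rewrite rpred_div ?rpred_nat.
by rewrite -(mulr_natr x) mulfK // pnatr_eq0 -lt0n.
Qed.

(** The gcd of the irreducible [p] with its derivative is 1 or [p]; the latter cannot divide a
    nonzero polynomial of smaller degree. *)
Lemma minCpoly_separable (x : algC) : separable_poly (minCpoly x).
Proof.
have [p [Dp p_mon] minp] := minCpolyP x.
rewrite Dp separable_map.
have sp : (1 < size p)%N by rewrite -(size_map_poly (@ratr algC)) -Dp size_minCpoly.
have p'0 : p^`() != 0.
  apply/eqP => /(congr1 (fun q : {poly rat} => q`_(size p).-2)).
  rewrite coef_deriv coef0 prednK; last by rewrite -subn1 ltn_subRL addn0.
  by rewrite -lead_coefE (monicP p_mon) => /eqP; rewrite pnatr_eq0 -subn1 subn_eq0 leqNgt sp.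
have minq (q : {poly rat}) : q %| p -> (size q == 1)%N || (p %| q).
  case/dvdpP => r pE; have := root_minCpoly x; rewrite Dp {1}pE rmorphM rootM !minp.
  case/orP => [pr|-> ]; last by rewrite orbT.
  have r0 : r != 0 by apply: contra_eq_neq pE => ->; rewrite mul0r monic_neq0.
  have q0 : q != 0 by apply: contra_eq_neq pE => ->; rewrite mulr0 monic_neq0.
  have := dvdp_leq r0 pr; rewrite pE size_mul // -subn1.
  by move: q0; rewrite -size_poly_gt0; case: (size q) => [|[|n]] //= _ H; exfalso; lia.
rewrite separable_poly.unlock /coprimep; have /orP[//|pg] := minq _ (dvdp_gcdl p p^`()).
have := dvdp_leq p'0 (dvdp_trans pg (dvdp_gcdr p p^`())).
by rewrite leqNgt lt_size_deriv ?monic_neq0.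
Qed.

Lemma minCpoly_conj (x y : algC) : root (minCpoly x) y -> minCpoly y = minCpoly x.
Proof. by case/algC_conj_aut => nu <-; rewrite minCpoly_aut. Qed.

Lemma conjsE (a : algC) : minCpoly a = \prod_(z <- conjs a) ('X - z%:P).
Proof.
rewrite /conjs; case: closed_field_poly_normal => rs /= {1}->.
by rewrite (monicP (minCpoly_monic a)) scale1r.
Qed.

Lemma mem_conjs (a z : algC) : (z \in conjs a) = root (minCpoly a) z.
Proof. by rewrite conjsE root_prod_XsubC. Qed.

Lemma uniq_conjs (a : algC) : uniq (conjs a).
Proof. by rewrite -separable_prod_XsubC -conjsE minCpoly_separable. Qed.

Lemma size_conjs (a : algC) : size (conjs a) = degA a.
Proof. by rewrite /degA conjsE size_prod_XsubC. Qed.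

Lemma degA_gt0 (a : algC) : (0 < degA a)%N.
Proof. by rewrite /degA; have := size_minCpoly a; case: (size _) => [|[]]. Qed.

(* The Galois group of the field generated by the r i, acting on the indices. *)
Definition galR d (r : 'I_d -> algC) : {set 'S_d} :=
  [set s : 'S_d | `[< exists nu : {rmorphism algC -> algC}, forall i, nu (r i) = r (s i) >]].

Lemma galRP d (r : 'I_d -> algC) (s : 'S_d) :
  reflect (exists nu : {rmorphism algC -> algC}, forall i, nu (r i) = r (s i)) (s \in galR r).
Proof. by rewrite inE; apply: asboolP. Qed.

Lemma galR_group_set d (r : 'I_d -> algC) : group_set (galR r).
Proof.
apply/group_setP; split=> [|s t /galRP[nu nuE] /galRP[mu muE]].
  by apply/galRP; exists idfun => i; rewrite perm1.
apply/galRP; exists (mu \o nu : {rmorphism algC -> algC}) => i /=.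
by rewrite nuE muE permM.
Qed.

Canonical galR_group d (r : 'I_d -> algC) : {group 'S_d} := group (galR_group_set r).

(** The degree is a separate parameter, so that all numbers of degree [d] share the index type
    ['I_d] and their Galois groups lie in the same ['S_d]. *)
Definition root_of d (a : algC) (i : 'I_d) : algC := (conjs a)`_i.

Arguments root_of : clear implicits.

Lemma root_of_inj d (a : algC) : degA a = d -> injective (root_of d a).
Proof.
move=> da i j /eqP.
by rewrite nth_uniq ?size_conjs ?uniq_conjs ?da ?ltn_ord // => /eqP/val_inj.
Qed.

Lemma root_ofP d (a z : algC) : degA a = d -> root (minCpoly a) z -> exists i, z = root_of d a i.
Proof.
move=> da; rewrite -mem_conjs => /(nthP 0)[i]; rewrite size_conjs da => lid <-.
by exists (Ordinal lid).
Qed.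

Lemma root_root_of d (a : algC) i : degA a = d -> root (minCpoly a) (root_of d a i).
Proof. by move=> da; rewrite -mem_conjs mem_nth ?size_conjs ?da. Qed.

Lemma big_conjs d (T : Type) (idx : T) (op : Monoid.law idx) (a : algC) (F : algC -> T) :
  degA a = d -> \big[op/idx]_(z <- conjs a) F z = \big[op/idx]_i F (root_of d a i).
Proof. by move=> da; rewrite (big_nth 0) size_conjs da big_mkord. Qed.

Lemma perm_of_aut d (r : 'I_d -> algC) (nu : {rmorphism algC -> algC}) :
  injective r -> (forall i, exists j, nu (r i) = r j) ->
  exists2 s : 'S_d, s \in galR r & forall i, nu (r i) = r (s i).
Proof.
move=> rinj /fin_all_exists[f fE].
have finj : injective f.
  by move=> i j fij; apply/rinj/(fmorph_inj nu); rewrite !fE fij.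
exists (perm finj) => [|i]; last by rewrite permE.
by apply/galRP; exists nu => i; rewrite permE.
Qed.

Lemma perm_of_aut_conjs d (a : algC) (nu : {rmorphism algC -> algC}) : degA a = d ->
  exists2 s : 'S_d, s \in galR (root_of d a) & forall i, nu (root_of d a i) = root_of d a (s i).
Proof.
move=> da; apply: perm_of_aut => [|k]; first exact: root_of_inj.
apply: root_ofP => //; rewrite -(minCpoly_conj (root_root_of k da)) -(minCpoly_aut nu).
exact: root_minCpoly.
Qed.

Lemma galR_trans d (a : algC) (i j : 'I_d) : degA a = d ->
  exists2 s, s \in galR (root_of d a) & s i = j.
Proof.
move=> da; have : root (minCpoly (root_of d a i)) (root_of d a j).
  by rewrite (minCpoly_conj (root_root_of i da)) root_root_of.
case/algC_conj_aut=> nu nuE; have [s sG sE] := perm_of_aut_conjs nu da.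
by exists s => //; apply: (root_of_inj da); rewrite -sE.
Qed.

(** * The divisor bound *)

Lemma leq_bin_exp2 n m : ('C(n, m) <= 2 ^ n)%N.
Proof.
elim: n m => [|n IHn] [|m]; rewrite ?bin0 ?expn_gt0 //.
by rewrite binS expnS mul2n -addnn leq_add.
Qed.

(** The left side is at most the falling factorial (a + q) ... (a + 1), which is q! times a binomial
    coefficient. *)
Lemma expn_le_fact_exp2 a q : (a.+1 ^ q <= q`! * 2 ^ (a + q))%N.
Proof.
apply: (@leq_trans ((a + q) ^_ q)).
  elim: q => [|q IHq]; first by rewrite ffactn0.
  by rewrite addnS ffactSS expnS leq_mul // ltnS leq_addr.
by rewrite -bin_ffact mulnC leq_mul2l leq_bin_exp2 orbT.
Qed.

Lemma leq_expn2r m n e : (m <= n)%N -> (m ^ e <= n ^ e)%N.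
Proof. by case: e => // e mn; rewrite leq_exp2r. Qed.

(** A divisor x is the product of gcd(x, p^a), one of a + 1 powers of p, and a cofactor which
    divides m. *)
Lemma size_divisors_pexp p a m : prime p -> (0 < m)%N ->
  (size (divisors (p ^ a * m)) <= a.+1 * size (divisors m))%N.
Proof.
move=> pp m0; have p0 := prime_gt0 pp.
pose s := [seq p ^ i * x | i <- iota 0 a.+1, x <- divisors m]%N.
have -> : (a.+1 * size (divisors m))%N = size s by rewrite size_allpairs size_iota.
apply: uniq_leq_size (divisors_uniq _) _ => x.
rewrite -dvdn_divisors ?muln_gt0 ?expn_gt0 ?p0 // => xd.
have /(dvdn_pfactor _ _ pp)[i ia gE] := dvdn_gcdr x (p ^ a).
have x0 : (0 < x)%N by apply: dvdn_gt0 xd; rewrite muln_gt0 expn_gt0 p0.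
have g0 : (0 < gcdn x (p ^ a))%N by rewrite gcdn_gt0 x0.
apply/allpairsP; exists (i, x %/ gcdn x (p ^ a))%N; split.
- by rewrite /fst mem_iota add0n ltnS.
- rewrite /snd -dvdn_divisors //.
  have cop : coprime (x %/ gcdn x (p ^ a)) (p ^ a %/ gcdn x (p ^ a)).
    by rewrite /coprime -(eqn_pmul2l g0) muln_gcdr ![(gcdn _ _ * (_ %/ _))%N]mulnC !divnK ?dvdn_gcdl ?dvdn_gcdr // muln1.
  rewrite -(Gauss_dvdr m cop) -(dvdn_pmul2l g0) mulnA.
  by rewrite ![(gcdn _ _ * (_ %/ _))%N]mulnC !divnK ?dvdn_gcdl ?dvdn_gcdr.
- by rewrite /= -gE mulnC divnK ?dvdn_gcdl.
Qed.

(** Prime powers p^a are split off one at a time. Only primes below 2^q cost a constant factor [C],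
    and there are fewer than 2^q of them. *)
Lemma size_divisors_subpolynomial q : exists K, forall n, (0 < n)%N -> (size (divisors n) ^ q <= K * n)%N.
Proof.
pose C := (q`! * 2 ^ q)%N.
pose sm n := [set p : 'I_(2 ^ q) | prime p && (p %| n)%N].
have C0 : (0 < C)%N by rewrite muln_gt0 fact_gt0 expn_gt0.
suff H n : (0 < n)%N -> (size (divisors n) ^ q <= C ^ #|sm n| * n)%N.
  exists (C ^ (2 ^ q))%N => n n0; apply: leq_trans (H n n0) _.
  rewrite leq_mul2r; apply/orP; right; rewrite leq_pexp2l //.
  by rewrite -[X in (_ <= X)%N]card_ord max_card.
elim/ltn_ind: n => n IH n0.
have [n1|n1] := leqP n 1.
  have -> : n = 1%N by lia.
  by rewrite /divisors /= exp1n muln1 expn_gt0 C0.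
have pp := pdiv_prime n1; set p := pdiv n in pp.
have [m copm nE] := pfactor_coprime pp n0; set a := logn p n in nE.
have a0 : (0 < a)%N by rewrite /a logn_gt0 mem_primes pp n0 pdiv_dvd.
have m0 : (0 < m)%N by move: n0; rewrite nE muln_gt0 => /andP[].
have mn : (m < n)%N by rewrite nE ltn_Pmulr // -(exp1n a) ltn_exp2r // prime_gt1.
have sub : sm m \subset sm n.
  apply/fintype.subsetP => x; rewrite !inE => /andP[-> xm] /=.
  by rewrite nE dvdn_mulr.
rewrite {1}nE mulnC.
apply: (@leq_trans ((a.+1 * size (divisors m)) ^ q)%N).
  by rewrite leq_expn2r // size_divisors_pexp.
rewrite expnMn; have := IH m mn m0 => IHm.
(* For small p, (a + 1)^q <= C 2^a <= C p^a. For p >= 2^q, (a + 1)^q <= (2^q)^a <= p^a, with no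
   constant. *)
have [plt|ple] := ltnP p (2 ^ q).
  have prp : sm m \proper sm n.
    rewrite properE sub; apply/fintype.subsetPn; exists (Ordinal plt); rewrite inE /= pp ?pdiv_dvd //=.
    by move: copm; rewrite prime_coprime.
  apply: (@leq_trans ((C * p ^ a) * (C ^ #|sm m| * m)))%N.
    apply: leq_mul => //; apply: leq_trans (expn_le_fact_exp2 _ _) _.
    by rewrite addnC expnD mulnA leq_mul2l leq_exp2r // prime_gt1 ?orbT.
  have -> : (C * p ^ a * (C ^ #|sm m| * m) = C ^ #|sm m|.+1 * n)%N.
    by rewrite expnS [in RHS]nE; ring.
  by rewrite leq_mul2r; apply/orP; right; rewrite leq_pexp2l // proper_card.
apply: (@leq_trans (p ^ a * (C ^ #|sm m| * m)))%N.
  apply: leq_mul => //; apply: (@leq_trans ((2 ^ q) ^ a)%N); last by rewrite leq_exp2r.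
  by rewrite -expnM mulnC expnM leq_expn2r // ltn_expl.
have -> : (p ^ a * (C ^ #|sm m| * m) = C ^ #|sm m| * n)%N by rewrite [in RHS]nE; ring.
by rewrite leq_mul2r; apply/orP; right; rewrite leq_pexp2l // subset_leq_card.
Qed.

(** * Galois orbits of index sets spanning the permutation module *)

Lemma mul_denq_int (x : rat) : (denq x)%:~R * x \is a Num.int.
Proof. by rewrite mulrC -numqE intr_int. Qed.

(* Dual form of: the indicators of the translates of S under G span Q^d. *)
Definition spans d (G : {set 'S_d}) (S : {set 'I_d}) : Prop :=
  forall w : 'I_d -> rat,
    (forall s, s \in G -> \sum_(i in S) w (s i) = 0) -> forall i, w i = 0.

(** The matrix [B], whose columns are the indicators of the translates of S (zero for permutations
    outside G), has trivial left kernel, hence a right inverse. [DE] is a common denominator of this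
    inverse together with its integral multiple; the integers serve as exponents of monomials. *)
Lemma spans_left_inverse d (G : {set 'S_d}) (S : {set 'I_d}) : spans G S ->
  exists DE : nat * ('I_d -> 'S_d -> int), (0 < DE.1)%N /\
    forall i j, \sum_(s in G) DE.2 i s *+ ((s^-1)%g j \in S) = (DE.1)%:Z *+ (i == j).
Proof.
move=> sp.
pose B : 'M[rat]_(d, #|{: 'S_d}|) := \matrix_(j, a)
   (((enum_val a : 'S_d) \in G) && (((enum_val a : 'S_d)^-1)%g j \in S))%:R.
have : row_free B.
  rewrite -kermx_eq0; apply/eqP/row_matrixP => l; rewrite row0.
  set w := row l (kermx B).
  have wB : w *m B = 0 by rewrite /w -row_mul mulmx_ker row0.
  apply/rowP => i; rewrite [RHS]mxE; apply: (sp (fun i => w 0 i)) => s sG.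
  have E : (w *m B) 0 (enum_rank s) = 0 by rewrite wB mxE.
  rewrite -[RHS]E mxE [RHS](reindex_inj (@perm_inj _ s)) /= big_mkcond /=.
  apply: eq_bigr => j _; rewrite [B _ _]mxE enum_rankK sG permK /=.
  by case: ifP => _; rewrite ?mulr1 ?mulr0.
case/row_freeP => C BC.
pose D : int := \prod_a \prod_i denq (C a i).
have D0 : 0 < D by apply: prodr_gt0 => a _; apply: prodr_gt0 => i _; apply: denq_gt0.
have DC a i : D%:~R * C a i \is a Num.int.
  rewrite /D (bigD1 a) //= (bigD1 i) //= !rmorphM /= mulrC !mulrA [C a i * _]mulrC.
  by rewrite rpredM ?intr_int // rpredM ?intr_int ?mul_denq_int.
exists (`|D|%N, fun i s => Num.floor (D%:~R * C (enum_rank s) i)); split=> /= [|i j].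
  by rewrite absz_gt0 gt_eqF.
apply: (@intr_inj rat); rewrite rmorph_sum /=.
have := congr1 (fun X : 'M[rat]_(d, d) => D%:~R * X j i) BC; rewrite !mxE eq_sym => E.
transitivity (D%:~R * (i == j)%:R : rat); last first.
  by case: (i == j); rewrite /= ?mulr1n ?mulr0n ?mulr1 ?mulr0 // -[in LHS](gtz0_abs D0).
rewrite -E mulr_sumr (reindex_onto enum_rank enum_val) /=; last by move=> a _; rewrite enum_valK.
rewrite big_mkcond /= [RHS]big_mkcond /=; apply: eq_bigr => s _.
rewrite enum_rankK eqxx [B _ _]mxE enum_rankK.
case: (s \in G); rewrite /= ?mul0r ?mulr0 //.
case: (_ \in S); rewrite /= ?mulr1n ?mulr0n ?mul0r ?mulr0 ?mul1r //.
by rewrite floorK.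
Qed.

Lemma spans_singleton d (G : {set 'S_d}) (S : {set 'I_d}) :
  (forall i j, exists2 s : 'S_d, s \in G & s i = j) -> #|S| = 1%N -> spans G S.
Proof.
move=> tr /eqP/cards1P[x ->] w wS j; have [s sG <-] := tr x j.
by rewrite -(wS s sG) big_set1.
Qed.

(** If x is the only point outside S, the relation for s says that w (s x) equals the total sum t of
    w. By transitivity w is constant equal to t, so t = d t and t = 0. *)
Lemma spans_cosingleton d (G : {set 'S_d}) (S : {set 'I_d}) :
  (forall i j, exists2 s : 'S_d, s \in G & s i = j) -> (1 < d)%N -> #|S| = d.-1 -> spans G S.
Proof.
move=> tr d1 Sd w wS.
have /eqP/cards1P[x Sx] : #|~: S| = 1%N.
  by have := cardsC S; rewrite card_ord Sd; lia.
have H j : w j = \sum_i w i.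
  have [s sG sx] := tr x j.
  have : \sum_i w (s i) = \sum_(i in S) w (s i) + w (s x).
    rewrite (bigID (mem S)) /=; congr (_ + _).
    by rewrite (eq_bigl (mem [set x])) ?big_set1 // => i; rewrite -Sx !inE.
  by rewrite wS // add0r sx => <-; rewrite [RHS](reindex_inj (perm_inj (s := s))).
have : \sum_i w i = (\sum_i w i) *+ d by rewrite {1}(eq_bigr _ (fun j _ => H j)) sumr_const card_ord.
have t0 (t : rat) : t = t *+ d -> t = 0.
  rewrite -[in X in X -> _](prednK (ltnW d1)) mulrS => /eqP.
  rewrite addrC eq_sym -subr_eq0 addrK mulrn_eq0 => /orP[/eqP ?|/eqP //]; lia.
by move/t0 => s0 j; rewrite H.
Qed.

(** The sum [u] of w over the powers of g satisfies the same relations and is constant off f. A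
    translate of S that misses f gives u = 0 off f; one that contains f then gives u f = 0, and u f
    is the order of g times w f. Translating w by G handles the other points. *)
Lemma spans_fixpt d (G : {group 'S_d}) (S : {set 'I_d}) (g : 'S_d) (f : 'I_d) :
  (forall i j, exists2 s : 'S_d, s \in G & s i = j) -> g \in G -> g f = f ->
  (forall i j, i != f -> j != f -> exists n, (g ^+ n)%g i = j) ->
  (0 < #|S| < d)%N -> spans G S.
Proof.
move=> tr gG gf gtr /andP[S0 Sd].
have key (w : 'I_d -> rat) :
    (forall s, s \in G -> \sum_(i in S) w (s i) = 0) -> w f = 0.
  move=> wS; pose u x := \sum_(t in <[g]>%g) w (t x).
  have uM x s : s \in <[g]>%g -> u (s x) = u x.
    move=> sH; rewrite /u [RHS](reindex_inj (mulgI s)) /=.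
    by apply: eq_big => [t|t _]; rewrite ?groupMl // permM.
  have uc x y : x != f -> y != f -> u x = u y.
    by move=> xf yf; have [n <-] := gtr _ _ xf yf; rewrite uM ?mem_cycle.
  have fixf t : t \in <[g]>%g -> t f = f.
    by case/cycleP => n ->; elim: n => [|n IHn]; rewrite ?expg0 ?perm1 // expgSr permM IHn.
  have uS s : s \in G -> \sum_(i in S) u (s i) = 0.
    move=> sG; rewrite exchange_big big1 //= => t tH.
    have tG : t \in G by apply: fintype.subsetP tH; rewrite cycle_subG.
    by rewrite -[RHS](wS (s * t)%g) ?groupM //; apply: eq_bigr => i _; rewrite permM.
  have [x xS] := card_gt0P S0.
  have [x' x'S] : exists x', x' \notin S.
    have : (0 < #|~: S|)%N by have := cardsC S; rewrite card_ord; lia.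
    by case/card_gt0P => x'; rewrite inE; exists x'.
  have [s2 s2G s2x] := tr x' f; have [s1 s1G s1x] := tr x f.
  have c0 y : y != f -> u y = 0.
    move=> yf; have := uS s2 s2G; rewrite (eq_bigr (fun=> u y)).
      by rewrite sumr_const => /eqP; rewrite mulrn_eq0 -leqn0 leqNgt S0 => /eqP.
    move=> i iS; apply: uc => //; rewrite -s2x (inj_eq perm_inj).
    by apply: contraNneq x'S => <-.
  have := uS s1 s1G; rewrite (bigD1 x) //= big1 ?addr0 ?s1x.
    rewrite /u (eq_bigr (fun=> w f)); last by move=> t /fixf->.
    by rewrite sumr_const => /eqP; rewrite mulrn_eq0 -leqn0 leqNgt cardG_gt0 => /eqP.
  by move=> i /andP[_ ix]; rewrite c0 // -s1x (inj_eq perm_inj).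
move=> w wS j; have [s sG <-] := tr f j.
apply: (key (fun i => w (s i))) => t tG.
rewrite -[RHS](wS (t * s)%g) ?groupM //; apply: eq_bigr => i _; by rewrite permM.
Qed.

(** Transitivity makes d divide the order of G, so Cauchy gives g of order d. Orbits of g have size
    1 or d, and since g is not the identity some orbit is everything. *)
Lemma prime_trans_cycle d (G : {group 'S_d}) : prime d ->
  (forall i j, exists2 s : 'S_d, s \in G & s i = j) ->
  exists2 g : 'S_d, g \in G & #[g]%g = d /\ forall i j, exists n, (g ^+ n)%g i = j.
Proof.
move=> pd tr; have d0 := prime_gt0 pd; pose x : 'I_d := Ordinal d0.
have dG : (d %| #|G|)%N.
  have oE : #|orbit 'P G x| = d.
    rewrite -[RHS]card_ord; apply: eq_card => y.
    by have [s sG <-] := tr x y; rewrite inE; apply/orbitP; exists s.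
  by rewrite -[X in (X %| _)%N]oE dvdn_orbit.
have [g gG og] := Cauchy pd dG; exists g => //; split=> // i j.
have [y yg] : exists y, g y != y.
  apply/existsP; apply: contraTT (prime_gt1 pd); rewrite negb_exists => /forallP gy.
  rewrite -leqNgt -og; have -> : g = 1%g by apply/permP => y; rewrite perm1; apply/eqP; rewrite -[_ == _]negbK.
  by rewrite order1.
have pT : porbit g y = [set: 'I_d].
  apply/eqP; rewrite eqEcard finset.subsetT cardsT card_ord /=.
  have : (#|porbit g y| %| #[g]%g)%N by rewrite porbit.unlock; exact: (dvdn_orbit 'P%act <[g]>%G y).
  rewrite og.
  have p1 : (1 < #|porbit g y|)%N.
    rewrite (cardD1 y) porbit_id (cardD1 (g y)) !inE yg -[g y]/((g ^+ 1)%g y) mem_porbit //.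
  by move: pd => /primeP[_ H] /H /orP[/eqP p1'|/eqP ->]; [rewrite p1' in p1|].
have /porbitP[m jE] : j \in porbit g y by rewrite pT inE.
have /porbitP[n iE] : y \in porbit g i by rewrite porbit_sym pT inE.
by exists (n + m)%N; rewrite expgD permM -iE -jE.
Qed.

(* Modulo d, the sum over S is F(T), with T the permutation matrix of a d-cycle and
   F a sum of |S| monomials, so F(T)^d = |S| is invertible; an integral relation w
   is then divisible by every power of d. *)
Lemma spans_prime d (G : {group 'S_d}) (S : {set 'I_d}) : prime d ->
  (forall i j, exists2 s : 'S_d, s \in G & s i = j) ->
  (0 < #|S| < d)%N -> spans G S.
Proof.
case: d G S => // d' G S pd tr /andP[S0 Sd].
have [g gG [og gtr]] := prime_trans_cycle pd tr.
have pchF : d'.+1 \in [pchar 'F_(d'.+1)] by rewrite pchar_Fp.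
have key (v : 'I_d'.+1 -> int) : (forall n, \sum_(i in S) v ((g ^+ n)%g i) = 0) ->
    forall i, (d'.+1%:Z %| v i)%Z.
  move=> vS.
  pose T : 'M['F_(d'.+1)]_d'.+1 := perm_mx g.
  have TE n : T ^+ n = perm_mx (g ^+ n)%g.
    by elim: n => [|n IHn]; rewrite ?expr0 ?expg0 ?perm_mx1 // exprS IHn expgS perm_mxM.
  have [a aE] := fin_all_exists (gtr (ord0 : 'I_d'.+1)).
  pose F : {poly 'F_(d'.+1)} := \sum_(i in S) 'X^(a i).
  pose w : 'cV['F_(d'.+1)]_d'.+1 := \col_i (v i)%:~R.
  have Fw : horner_mx T F *m w = 0.
    rewrite rmorph_sum /= mulmx_suml; apply/colP => j; rewrite summxE [RHS]mxE.
    have [n nE] := gtr (ord0 : 'I_d'.+1) j.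
    transitivity ((\sum_(i in S) v ((g ^+ n)%g i))%:~R : 'F_(d'.+1)); last by rewrite vS.
    rewrite rmorph_sum /=; apply: eq_bigr => i _.
    rewrite rmorphXn /= horner_mx_X TE -row_permE !mxE -nE -[in RHS](aE i).
    by rewrite -!permM -!expgD addnC.
  (* Taking d-th powers is additive in characteristic d, so F^d is the sum of the X^(d a_i), and
     each of these is 1 at T since T^d = 1. *)
  have FT : horner_mx T F ^+ d'.+1 = (#|S|%:R)%:M.
    rewrite -rmorphXn /=.
    have -> : F ^+ d'.+1 = \sum_(i in S) 'X^(a i * d'.+1).
      have pchP : d'.+1 \in [pchar {poly 'F_(d'.+1)}] by rewrite pchar_poly.
      rewrite -(pFrobenius_autE pchP) rmorph_sum /=; apply: eq_bigr => i _.
      by rewrite pFrobenius_autE -exprM.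
    rewrite rmorph_sum /= (eq_bigr (fun=> 1%:M)) => [|i _].
      by rewrite sumr_const -scaler_nat scalemx1.
    have gd : (g ^+ d'.+1 = 1)%g by rewrite -[X in (g ^+ X)%g]og expg_order.
    by rewrite rmorphXn /= horner_mx_X TE mulnC expgM gd expg1n perm_mx1.
  have Sw : #|S|%:R *: w = 0.
    rewrite -mul_scalar_mx -FT exprSr -mulmxE -mulmxA.
    by rewrite Fw mulmx0.
  have S_n0 : #|S|%:R != 0 :> 'F_(d'.+1).
    by rewrite -(dvdn_pcharf pchF) gtnNdvd.
  move=> i; have := congr1 (fun X : 'cV['F_(d'.+1)]_d'.+1 => X i 0) Sw.
  rewrite !mxE => /eqP; rewrite mulf_eq0 (negPf S_n0) /= => vi0.
  by rewrite (dvdz_pcharf pchF).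
(* Dividing an integral relation by d gives an integral relation again, so [key] can be iterated. *)
have key2 n (v : 'I_d'.+1 -> int) : (forall n, \sum_(i in S) v ((g ^+ n)%g i) = 0) ->
    forall i, (d'.+1%:Z ^+ n %| v i)%Z.
  elim: n v => [|n IHn] v vS i; first by rewrite expr0 dvd1z.
  have vd := key v vS.
  have vE j : v j = (v j %/ d'.+1%:Z)%Z * d'.+1%:Z by rewrite divzK.
  rewrite vE exprSr dvdz_mul //.
  apply: (IHn (fun j => (v j %/ d'.+1%:Z)%Z)) => m.
  have d_n0 : d'.+1%:Z != 0 by [].
  apply: (mulIf d_n0); rewrite mul0r mulr_suml -[RHS](vS m).
  by apply: eq_bigr => j _; rewrite -vE.
move=> w wS.
pose D : int := \prod_i denq (w i).
have D0 : D != 0 by apply/prodf_neq0 => i _; apply: denq_neq0.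
have Dw i : D%:~R * w i \is a Num.int.
  rewrite /D (bigD1 i) //= !rmorphM /= mulrAC.
  by rewrite rpredM ?mul_denq_int ?intr_int.
pose v i := Num.floor (D%:~R * w i).
have vE i : (v i)%:~R = D%:~R * w i by rewrite /v floorK.
have vS n : \sum_(i in S) v ((g ^+ n)%g i) = 0.
  apply: (@intr_inj rat); rewrite rmorph_sum /= (eq_bigr _ (fun i _ => vE _)).
  by rewrite -mulr_sumr wS ?mulr0 ?groupX.
move=> i; have := vE i; have -> : v i = 0.
  (* The exponent |v i| already suffices: d^|v i| exceeds |v i|, so it cannot divide a nonzero v
     i. *)
  apply/eqP; rewrite -absz_eq0; apply: contraT; rewrite -lt0n => v0.
  have := key2 `|v i|%N v vS i; rewrite dvdzE abszX => /dvdn_leq -/(_ v0).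
  by rewrite leqNgt ltn_expl // prime_gt1.
by move/esym/eqP; rewrite mulf_eq0 intr_eq0 (negPf D0) => /eqP.
Qed.

(** * Numbers of given Mahler measure *)

Lemma denomA_gt0 (a : algC) : 0 < denomA a.
Proof. by apply: prodr_gt0 => c _; apply: denq_gt0. Qed.

Lemma denomA_mul_int (a : algC) i : (minQpoly a)`_i * (denomA a)%:~R \is a Num.int.
Proof.
have [li|] := ltnP i (size (minQpoly a)); last by move/(nth_default 0) ->; rewrite mul0r rpred0.
rewrite /denomA (big_rem _ (mem_nth 0 li)) /= rmorphM /= mulrA.
by rewrite rpredM ?intr_int // mulrC mul_denq_int.
Qed.

(** [denomA a] clears every denominator of [minQpoly a], so [numq] loses nothing: the polynomial [Q]
    made primitive is exactly [denomA a] times [minQpoly a], with positive content. *)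
Lemma minZpoly_spec (a : algC) :
  [/\ 0 < lead0 a, map_poly intr (minZpoly a) = (lead0 a)%:~R *: minCpoly a
    & zcontents (minZpoly a) = 1].
Proof.
set Q := \poly_(i < size (minQpoly a)) numq ((minQpoly a)`_i * (denomA a)%:~R).
have [p1 p2] : minCpoly a = map_poly ratr (minQpoly a) /\ minQpoly a \is monic.
  by rewrite /minQpoly; case: minCpolyP.
have QE : map_poly intr Q = (denomA a)%:~R *: minQpoly a :> {poly rat}.
  apply/polyP => i; rewrite coef_map coef_poly coefZ /=.
  case: ltnP => li; last by rewrite (nth_default 0 li) mulr0.
  by have /intrP[m mE] := denomA_mul_int a i; rewrite mE numq_int -mE mulrC.
have D0 := denomA_gt0 a.
have lQ : lead_coef Q = denomA a.
  apply: (@intr_inj rat); rewrite -lead_coef_map_inj //; last exact: intr_inj.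
  by rewrite QE lead_coefZ (monicP p2) mulr1.
have c0 : 0 < zcontents Q by rewrite -sgz_gt0 sgz_contents lQ sgz_gt0.
have QP : Q = zcontents Q *: minZpoly a by rewrite /minZpoly -/Q -zpolyEprim.
have lc : lead_coef Q = zcontents Q * lead0 a by rewrite {1}QP lead_coefZ.
have l0 : 0 < lead0 a by rewrite -(pmulr_rgt0 _ c0) -lc lQ.
split=> //.
  have ZE : map_poly intr (minZpoly a) = (lead0 a)%:~R *: minQpoly a :> {poly rat}.
    have c0' : (zcontents Q)%:~R != 0 :> rat by rewrite intr_eq0 gt_eqF.
    apply: (scalerI c0'); rewrite scalerA -intrM -lc lQ -QE [in RHS]QP.
    by rewrite map_polyZ.
  rewrite p1 -[(lead0 a)%:~R](ratr_int algC) -map_polyZ -ZE -[RHS]map_poly_comp.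
  by apply: eq_map_poly => m /=; rewrite ratr_int.
by rewrite /minZpoly -/Q zcontents_primitive; case: eqP => // Q0; rewrite Q0 zcontents0 in c0.
Qed.

Lemma lead0_gt0 (a : algC) : 0 < lead0 a.
Proof. by case: (minZpoly_spec a). Qed.

(** Conjugates on the unit circle are included, so that this is the complement of the open disk;
    they contribute a factor of absolute value 1 to the Mahler measure. *)
Definition outS d (a : algC) : {set 'I_d} := [set i | 1 <= `|root_of d a i|].

Arguments outS : clear implicits.

Lemma card_outS d (a : algC) : degA a = d -> (#|outS d a| + n_in_disk a = d)%N.
Proof.
move=> da; rewrite /n_in_disk -sum1_count big_mkcond (big_conjs (d := d)) //= -big_mkcond /=.
rewrite sum1_card -[RHS]card_ord -(cardC (mem (outS d a))); congr (_ + _)%N.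
by apply: eq_card => i; rewrite !inE [LHS]real_ltNge ?normr_real.
Qed.

Lemma prod_max_outS d (a : algC) : degA a = d ->
  \prod_(z <- conjs a) Num.max 1 `|z| = \prod_(i in outS d a) `|root_of d a i|.
Proof.
move=> da; rewrite (big_conjs (d := d)) //= [RHS]big_mkcond /=; apply: eq_bigr => i _.
rewrite inE /Order.max; case: real_ltgtP; rewrite ?normr_real //.
Qed.

Lemma mahler_outS d (a : algC) : degA a = d ->
  mahler a = (lead0 a)%:~R * \prod_(i in outS d a) `|root_of d a i|.
Proof. by move=> da; rewrite /mahler (prod_max_outS da). Qed.

Lemma mahler_ge1 (a : algC) : 1 <= mahler a.
Proof.
rewrite (mahler_outS (erefl (degA a))) mulr_ege1 //.
  by rewrite -[1]/(1%:~R) ler_int; apply: lead0_gt0.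
by apply: (big_ind (fun x => 1 <= x)) => // [x y x1 y1|i]; [rewrite mulr_ege1|rewrite inE].
Qed.

(** Complex conjugation permutes the conjugates outside the disk, so their product is real and
    equals its absolute value up to sign. *)
Lemma mahler_sign d (a : algC) : degA a = d ->
  exists b : bool, mahler a = (-1) ^+ b * ((lead0 a)%:~R * \prod_(i in outS d a) root_of d a i).
Proof.
move=> da; rewrite (mahler_outS da) -normr_prod.
set x := \prod_(i in outS d a) _.
have xreal : x \is Num.real.
  have [s sG sE] := perm_of_aut_conjs (Num.conj : {rmorphism algC -> algC}) da.
  apply/CrealP; rewrite /x rmorph_prod [RHS](reindex_inj (@perm_inj _ s)) /=.
  apply: eq_big => [i|i _]; last exact: sE.
  by rewrite !inE -sE norm_conjC.
case: (real_ge0P xreal) => _; first by exists false; rewrite expr0 mul1r.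
by exists true; rewrite expr1 mulN1r mulrN.
Qed.

(** Automorphisms act on the signed product by permuting the roots. The last clause bounds the
    number of conjugates of M by d!. *)
Lemma prod_in_galR d (a : algC) : degA a = d ->
  exists2 b : bool, mahler a = (-1) ^+ b * ((lead0 a)%:~R * \prod_(i in outS d a) root_of d a i)
  & (forall s, s \in galR (root_of d a) ->
    (-1) ^+ b * ((lead0 a)%:~R * \prod_(i in outS d a) root_of d a (s i)) \in conjs (mahler a))
  /\ (forall z, z \in conjs (mahler a) -> exists s : 'S_d,
    z = (-1) ^+ b * ((lead0 a)%:~R * \prod_(i in outS d a) root_of d a (s i))).
Proof.
move=> da; have [b ME] := mahler_sign da; exists b => //.
have nuE (nu : {rmorphism algC -> algC}) (s : 'S_d) : (forall i, nu (root_of d a i) = root_of d a (s i)) ->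
    nu (mahler a) = (-1) ^+ b * ((lead0 a)%:~R * \prod_(i in outS d a) root_of d a (s i)).
  move=> sE; rewrite ME rmorphMsign rmorphM rmorph_int rmorph_prod; congr (_ * (_ * _)).
  by apply: eq_bigr => i _; apply: sE.
split=> [s /galRP[nu sE]|z].
  by rewrite -(nuE _ _ sE) mem_conjs -(minCpoly_aut nu) root_minCpoly.
rewrite mem_conjs => /algC_conj_aut[nu <-].
by have [s _ sE] := perm_of_aut_conjs nu da; exists s; rewrite (nuE _ _ sE).
Qed.

Lemma degA0 : (degA 0%R <= 1)%N.
Proof.
rewrite /degA; have [p [-> pm] pE] := minCpolyP (0 : algC).
have : p %| 'X by rewrite -pE map_polyX rootX.
by move/(dvdp_leq (negbT (polyX_eq0 _))); rewrite size_polyX size_map_poly; case: (size p) => [|[|[]]].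
Qed.

Lemma root_of_neq0 d (a : algC) (i : 'I_d) : degA a = d -> (1 < d)%N -> root_of d a i != 0.
Proof.
move=> da d1; apply/eqP => ri0.
have := minCpoly_conj (root_root_of i da); rewrite ri0 => E.
by have := degA0; rewrite /degA E -/(degA a) da leqNgt d1.
Qed.

Lemma prod_root_of d (a : algC) : degA a = d ->
  (lead0 a)%:~R * \prod_i root_of d a i = (-1) ^+ d * ((minZpoly a)`_0)%:~R.
Proof.
move=> da; have [_ /(congr1 (fun p : {poly algC} => p`_0)) ZE _] := minZpoly_spec a.
move: ZE; rewrite coef_map coefZ /= => ->.
rewrite conjsE coef0_prod.
have H (z : algC) : ('X - z%:P)`_0 = - z by rewrite coefB coefX coefC sub0r.
rewrite (eq_bigr _ (fun z _ => H z)).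
rewrite (big_conjs (d := d)) //= prodrN card_ord [RHS]mulrCA signrMK //.
Qed.

(** The exponent of r j on the right is the sum in the hypothesis, that is D if j = i and 0
    otherwise. *)
Lemma root_pow_monomial d (r : 'I_d -> algC) (G : {set 'S_d}) (S : {set 'I_d}) (D : nat) (E : 'I_d -> 'S_d -> int) :
  (forall i, r i != 0) ->
  (forall i j, \sum_(s in G) E i s *+ ((s^-1)%g j \in S) = D%:Z *+ (i == j)) ->
  forall i, r i ^+ D = \prod_(s in G) (\prod_(j in S) r (s j)) ^ (E i s).
Proof.
move=> r0 ES i.
have H (s : 'S_d) : (\prod_(j in S) r (s j)) ^ (E i s) = \prod_j r j ^ (E i s *+ ((s^-1)%g j \in S)).
  rewrite (big_morph (fun x => x ^ (E i s)) (fun x y => expfzMl x y _) (exp1rz _ _)) /=.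
  rewrite [RHS](reindex_inj (@perm_inj _ s)) big_mkcond /=; apply: eq_bigr => j _.
  by rewrite permK; case: ifP => _; rewrite ?mulr1n ?mulr0n ?expr0z.
under eq_bigr do rewrite H.
rewrite exchange_big (bigD1 i) //= [X in _ * X]big1 ?mulr1 => [|j ji].
  by rewrite -(big_morph _ (fun x y => expfzDr x y (r0 i)) (expr0z _)) ES eqxx mulr1n.
by rewrite -(big_morph _ (fun x y => expfzDr x y (r0 j)) (expr0z _)) ES eq_sym (negPf ji) mulr0n expr0z.
Qed.

Lemma size_flatten_leq (T : eqType) (ss : seq (seq T)) m :
  (forall s, s \in ss -> (size s <= m)%N) -> (size (flatten ss) <= size ss * m)%N.
Proof.
elim: ss => //= s ss IH H; rewrite size_cat mulSn leq_add ?H ?mem_head //.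
by apply: IH => t tss; apply: H; rewrite inE tss orbT.
Qed.

(** By transitivity the product [R j] of r (s j) over the group does not depend on j, and the
    product of all d of them is the norm to the power |G|. *)
Lemma prod_galR d (a : algC) : degA a = d ->
  (\prod_(s in galR (root_of d a)) \prod_(j in outS d a) root_of d a (s j)) ^+ d
    = (\prod_j root_of d a j) ^+ (#|galR (root_of d a)| * #|outS d a|).
Proof.
move=> da; set G := galR _; set r := root_of d a.
pose R j := \prod_(s in G) r (s j).
have Rc i j : R i = R j.
  have [t tG <-] := galR_trans j i da.
  rewrite /R [RHS](reindex_inj (mulgI t)) /=.
  apply: eq_big => [s|s _]; last by rewrite permM.
  by rewrite (groupMl _ (G := galR_group r)).
have Rd i : R i ^+ d = (\prod_j r j) ^+ #|G|.
  have <- : \prod_j R j = R i ^+ d.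
    by rewrite (eq_bigr (fun=> R i)) => [|j _]; [rewrite prodr_const card_ord|exact: Rc].
  rewrite exchange_big /=.
  rewrite -prodr_const; apply: eq_bigr => s sG.
  by rewrite [RHS](reindex_inj (@perm_inj _ s)).
rewrite exchange_big /=.
have [->|[i iS]] := set_0Vmem (outS d a).
  by rewrite big_set0 cards0 muln0 expr1n.
rewrite (eq_bigr (fun=> R i)) => [|j _]; last exact: Rc.
by rewrite prodr_const -exprM mulnC exprM Rd -exprM.
Qed.

(** With l the leading and c the absolute constant coefficient, the product of all roots has
    absolute value c / l, so the right side is l^(|G| (d - |S|)) c^(|G| |S|). As |S| < d, the
    exponent of l stays positive. *)
Lemma lead0_dvd_norm d (a : algC) (b : bool) : degA a = d -> (0 < #|outS d a| < d)%N ->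
  exists2 n, [&& 0 < n & `|lead0 a| %| n]%N & n%:R =
  `|(\prod_(s in galR (root_of d a))
     ((-1) ^+ b * ((lead0 a)%:~R * \prod_(i in outS d a) root_of d a (s i)))) ^+ d|.
Proof.
move=> da /andP[S0 Sd]; set G := galR _; set S := outS d a in S0 Sd *.
have d1 : (1 < d)%N by lia.
have G0 : (0 < #|G|)%N by apply: (cardG_gt0 (galR_group _)).
have l0 := lead0_gt0 a.
have lN : (lead0 a)%:~R = `|lead0 a|%:R :> algC by rewrite -[in LHS](gtz0_abs l0).
set l := `|lead0 a|%N in lN *; pose a0 : int := (minZpoly a)`_0; pose c := `|a0|%N.
have l_gt0 : (0 < l)%N by rewrite absz_gt0 gt_eqF.
have lr : `|\prod_i root_of d a i| = c%:R / l%:R.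
  have := congr1 Num.norm (prod_root_of da); rewrite normrM normrMsign lN normr_nat.
  move=> H; apply: (@mulfI _ l%:R); first by rewrite pnatr_eq0 -lt0n.
  by rewrite mulrC in H *; rewrite H mulrC divfK ?pnatr_eq0 -?lt0n // /c -intr_norm natr_absz.
have c0 : (0 < c)%N.
  rewrite lt0n; apply/eqP => c0; move: lr; rewrite c0 mul0r => /normr0_eq0/eqP.
  by case/prodf_eq0 => i _; rewrite (negPf (root_of_neq0 i da d1)).
exists (l ^ (#|G| * (d - #|S|)) * c ^ (#|G| * #|S|))%N.
  rewrite muln_gt0 !expn_gt0 l_gt0 c0 /= dvdn_mulr // dvdn_exp // muln_gt0 G0 subn_gt0 //.
rewrite !big_split /= !prodr_const !exprMn prod_galR // !normrM !normrX lr normrN1 !expr1n mul1r.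
rewrite lN normr_nat natrM !natrX expr_div_n mulrCA mulrC -!exprM mulnBr.
have ln0 : l%:R != 0 :> algC by rewrite pnatr_eq0 -lt0n.
by congr (_ * _); rewrite expfB_cond // (negPf ln0) leq_mul2l (ltnW Sd) orbT.
Qed.

(** Any product of distinct roots is bounded by the product of all max(1, |root|). *)
Lemma norm_conj_mahler d (a : algC) (b : bool) (s : 'S_d) : degA a = d ->
  `|(-1) ^+ b * ((lead0 a)%:~R * \prod_(i in outS d a) root_of d a (s i))| <= mahler a.
Proof.
move=> da; rewrite normrM normr_sign mul1r normrM normr_prod /mahler.
rewrite ger0_norm ?ler0z ?(ltW (lead0_gt0 a)) // ler_wpM2l ?ler0z ?(ltW (lead0_gt0 a)) //.
have m1 (z : algC) : 1 <= Num.max 1 `|z| /\ `|z| <= Num.max 1 `|z|.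
  by rewrite /Order.max; case: (real_ltP (real1 algC) (normr_real z)) => h; split=> //; apply: ltW.
rewrite (big_conjs (d := d)) //= [leRHS](reindex_inj (@perm_inj _ s)) /= [leRHS](bigID (mem (outS d a))) /=.
rewrite -[leLHS]mulr1 ler_pM ?prodr_ge0 //.
  by apply: ler_prod => i _; rewrite normr_ge0 (m1 _).2.
by apply: (big_ind (fun x => 1 <= x)) => // [x y x1 y1|i _]; [rewrite mulr_ege1|apply: (m1 _).1].
Qed.

Definition good d (a : algC) := spans (galR (root_of d a)) (outS d a).

Arguments good : clear implicits.

(* A candidate alpha is a root of 'X^D - val x l, where x records G, S, a sign, the index of
   alpha and the labelling of the conjugates of M by G, and l is a divisor of tn x, a positive
   integer at most M^c, that stands for the leading coefficient. *)
Theorem fiber_bound d q : (0 < q)%N -> exists K : nat, forall M : algC, 1 <= M ->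
  exists2 s : seq algC, ((size s) ^ q)%:R <= K%:R * M &
    forall a, degA a = d -> mahler a = M -> (0 < #|outS d a| < d)%N -> good d a -> a \in s.
Proof.
move=> q0.
have [d0|d0] := posnP d.
  exists 0%N => M _; exists [::] => [|a _ _]; first by rewrite /= exp0n ?mul0r.
  by rewrite d0 ltn0 andbF.
have /choice[DE DEP] : forall x : {set 'S_d} * {set 'I_d}, exists y : nat * ('I_d -> 'S_d -> int),
    spans x.1 x.2 -> (0 < y.1)%N /\ forall i j,
      \sum_(s in x.1) y.2 i s *+ ((s^-1)%g j \in x.2) = (y.1)%:Z *+ (i == j).
  move=> x.
  have [/spans_left_inverse[y yP]|ns] := pselect (spans x.1 x.2); first by exists y.
  by exists (0%N, fun _ _ => 0).
(* For the label of an actual alpha, [T x] is the d-th power of a product of at most d! numbers of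
   absolute value at most M, hence at most M^c. The divisor bound is taken with exponent q c, so
   that a c-th root leaves a single power of M. *)
pose c := (d`! * d)%N.
have c0 : (0 < c)%N by rewrite muln_gt0 fact_gt0.
have [K1 K1P] := size_divisors_subpolynomial (q * c).
pose X := ({set 'S_d} * {set 'I_d} * (bool * 'I_d * {ffun 'S_d -> 'I_(d`!)}))%type.
pose Dm := \max_(x : {set 'S_d} * {set 'I_d}) (DE x).1.
exists ((#|{: X}| * Dm) ^ q * (K1.+1))%N => M M1.
have M0 : 0 <= M by apply: le_trans M1.
pose z (x : X) s := (conjs M)`_(x.2.2 s).
pose T (x : X) := `|(\prod_(s in x.1.1) z x s) ^+ d|.
pose tn x := `|Num.floor (T x)|%N.
(* Labels not coming from any alpha could give a zero or huge [tn x]; they are discarded, so that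
   the divisor bound controls the maximum [B]. *)
pose P x := (0 < tn x)%N && ((tn x)%:R <= M ^+ c).
pose val (x : X) (l : nat) := \prod_(s in x.1.1) ((-1) ^+ x.2.1.1 * z x s / l%:R) ^ ((DE x.1).2 x.2.1.2 s).
pose rts (x : X) (l : nat) := sval (closed_field_poly_normal ('X^((DE x.1).1) - (val x l)%:P)).
pose B := \max_(x : X | P x) size (divisors (tn x)).
exists (flatten [seq flatten [seq rts x l | l <- divisors (tn x) & (0 < (DE x.1).1)%N] | x <- enum {: X} & P x]).
  have sz : (size (flatten [seq flatten [seq rts x l | l <- divisors (tn x) & (0 < (DE x.1).1)%N] | x <- enum {: X} & P x])
      <= #|{: X}| * (B * Dm))%N.
    apply: leq_trans (size_flatten_leq (m := (B * Dm)%N) _) _.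
      move=> s /mapP[x]; rewrite mem_filter => /andP[Px _] ->.
      apply: leq_trans (size_flatten_leq (m := Dm) _) _.
        move=> t /mapP[l]; rewrite mem_filter => /andP[D0 _] ->.
        rewrite /rts; case: closed_field_poly_normal => rs /= E.
        apply: (@leq_trans (DE x.1).1); last by apply: (@leq_bigmax _ (fun x => (DE x).1)).
        have lc1 := monicP (monicXnsubC (val x l) D0).
        have := size_XnsubC (val x l) D0; rewrite {1}E lc1 scale1r size_prod_XsubC.
        by case => ->.
      rewrite leq_mul2r; apply/orP; right; rewrite size_map size_filter.
      by apply: leq_trans (count_size _ _) _; apply: (leq_bigmax_cond (F := fun x => size (divisors (tn x)))).
    rewrite leq_mul2r; apply/orP; right; rewrite size_map size_filter.
    by apply: leq_trans (count_size _ _) _; rewrite cardE.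
  have BM : (B ^ (q * c))%:R <= K1%:R * M ^+ c.
    rewrite /B; elim/big_ind: _ => [|x y xM yM|x /andP[x0 xM]].
    - apply: (@le_trans _ _ 0); first by rewrite exp0n // muln_gt0 q0.
      by rewrite mulr_ge0 ?exprn_ge0.
    - by rewrite /maxn; case: ifP.
    - apply: (@le_trans _ _ (K1 * tn x)%:R); first by rewrite ler_nat K1P.
      by rewrite natrM ler_wpM2l.
  have Bq : (B ^ q)%:R <= K1.+1%:R * M.
    rewrite -(@ler_pXn2r _ c) ?nnegrE ?mulr_ge0 // -natrX -expnM.
    apply: le_trans BM _; rewrite exprMn ler_wpM2r ?exprn_ge0 //.
    rewrite -natrX ler_nat; apply: (@leq_trans (K1.+1 ^ 1)%N); first by rewrite expn1.
    by rewrite leq_pexp2l.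
  apply: (@le_trans _ _ (((#|{: X}| * Dm) ^ q * B ^ q)%N%:R)).
    rewrite ler_nat -expnMn leq_expn2r //; apply: leq_trans sz _.
    by rewrite -mulnA [(B * _)%N]mulnC.
  by rewrite natrM [in leRHS]natrM -mulrA ler_wpM2l.
move=> a da aM Scard ga.
have d1 : (1 < d)%N by lia.
have r0 i := root_of_neq0 i da d1.
have [b ME [Gin inG]] := prod_in_galR da; rewrite aM in ME Gin inG.
pose v (s : 'S_d) := (-1) ^+ b * ((lead0 a)%:~R * \prod_(i in outS d a) root_of d a (s i)).
have sM : (size (conjs M) <= d`!)%N.
  rewrite -card_Sn cardE -(size_map v); apply: uniq_leq_size (uniq_conjs _) _ => y /inG[s ->].
  by apply: map_f; rewrite mem_enum.
(* [f s] is the position in [conjs M] of the conjugate of M obtained from s; this is the labelling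
   stored in [x]. *)
have [f fP] : exists f : 'S_d -> 'I_(d`!), forall s, s \in galR (root_of d a) -> (conjs M)`_(f s) = v s.
  apply: (@fin_all_exists _ _ (fun s k => s \in galR (root_of d a) -> (conjs M)`_(k : 'I_(d`!)) = v s)) => s.
  have [sG|] := boolP (s \in galR (root_of d a)); last by exists (Ordinal (fact_gt0 d)).
  have li : (index (v s) (conjs M) < d`!)%N by apply: leq_trans sM; rewrite index_mem Gin.
  by exists (Ordinal li) => _ /=; rewrite nth_index // Gin.
have [i ai] := root_ofP da (root_minCpoly a).
pose x : X := ((galR (root_of d a), outS d a), (b, i, [ffun s => f s])).
have zE s : s \in galR (root_of d a) -> z x s = v s by move=> sG; rewrite /z /= ffunE fP.
have [n /andP[n0 ln] nE] := lead0_dvd_norm b da Scard.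
have TE : T x = n%:R.
  by rewrite /T nE (eq_bigr _ zE).
have tE : tn x = n by rewrite /tn TE -[n%:R]/((n%:Z)%:~R) intrKfloor.
have Px : P x.
  rewrite /P tE n0 -TE /T normrX normr_prod /=.
  rewrite /c exprM ler_pXn2r ?nnegrE ?prodr_ge0 ?exprn_ge0 //.
  apply: (@le_trans _ _ (\prod_(s in galR (root_of d a)) M)).
    by apply: ler_prod => s sG; rewrite normr_ge0 zE // -aM norm_conj_mahler.
  by rewrite prodr_const ler_weXn2l // -card_Sn max_card.
have [D0 EP] := DEP x.1 ga.
apply/flattenP; exists (flatten [seq rts x l | l <- divisors (tn x) & (0 < (DE x.1).1)%N]).
  by apply: map_f; rewrite mem_filter Px mem_enum.
apply/flattenP; exists (rts x `|lead0 a|%N).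
  by apply: map_f; rewrite mem_filter D0 -dvdn_divisors tE.
rewrite /rts; case: closed_field_poly_normal => rs /= E.
have lc1 := monicP (monicXnsubC (val x `|lead0 a|%N) D0).
rewrite lc1 scale1r in E.
rewrite -root_prod_XsubC -E rootE hornerD hornerN hornerXn hornerC subr_eq0; apply/eqP.
rewrite {1}ai (root_pow_monomial r0 EP) /val; apply: eq_bigr => s sG; rewrite zE //.
congr (_ ^ _); rewrite /v signrMK.
have -> : `|lead0 a|%:R = (lead0 a)%:~R :> algC by rewrite -[in RHS](gtz0_abs (lead0_gt0 a)).
by rewrite mulrAC mulfV ?mul1r // intr_eq0 gt_eqF ?lead0_gt0.
Qed.

(** * Frobenius elements *)

(** The algebraic integers as a ring type, so that they have quotient rings and morphisms to fields
    of characteristic p. *)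
Record algInt := AlgInt { algIntval : algC; algIntvalP : algIntval \in Aint }.

HB.instance Definition _ := [isSub for algIntval].
HB.instance Definition _ := [Equality of algInt by <:].
HB.instance Definition _ := [Choice of algInt by <:].
HB.instance Definition _ := [SubChoice_isSubComNzRing of algInt by <:].

Lemma algIntval_is_zmod_morphism : zmod_morphism algIntval.
Proof. by []. Qed.

Lemma algIntval_is_monoid_morphism : monoid_morphism algIntval.
Proof. by []. Qed.

HB.instance Definition _ :=
  GRing.isZmodMorphism.Build algInt algC algIntval algIntval_is_zmod_morphism.
HB.instance Definition _ :=
  GRing.isMonoidMorphism.Build algInt algC algIntval algIntval_is_monoid_morphism.

Lemma algIntval_inj : injective algIntval.
Proof. exact: val_inj. Qed.

Definition is_ideal (I : set algInt) : Prop :=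
  [/\ I 0, forall x y, I x -> I y -> I (x - y) & forall u x, I x -> I (u * x)].

Lemma is_idealD (I : set algInt) x y : is_ideal I -> I x -> I y -> I (x + y).
Proof.
by move=> [I0 IB _] Ix Iy; rewrite -[y]opprK; apply: (IB) => //; rewrite -sub0r; apply: IB.
Qed.

(** Otherwise 1 / p would be a rational algebraic integer, hence an integer. So p generates a proper
    ideal. *)
Lemma algInt_pchar_proper p (x : algInt) : prime p -> p%:R * x <> 1.
Proof.
move=> pp px; have /(congr1 algIntval) := px; rewrite rmorphM rmorph_nat rmorph1 => E.
have p0 : p%:R != 0 :> algC by rewrite pnatr_eq0 -lt0n prime_gt0.
have xE : algIntval x = p%:R^-1 by apply: (mulfI p0); rewrite E mulfV.
have /Cint_rat_Aint : algIntval x \in Crat by rewrite xE rpredV rpred_nat.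
move/(_ (algIntvalP x)); rewrite xE => /intrP[m mE].
have : (p%:Z * m)%:~R = 1 :> algC by rewrite intrM -mE mulfV.
move/eqP; rewrite -[1]/(1%:~R) eqr_int => /eqP /(congr1 absz); rewrite abszM /= => /eqP.
by rewrite muln_eq1 => /andP[/eqP p1 _]; rewrite p1 in pp.
Qed.

Lemma maximal_ideal_exists p : prime p -> exists I : set algInt,
  [/\ is_ideal I, I p%:R, ~ I 1 & forall x, ~ I x -> exists u, I (1 - u * x)].
Proof.
move=> pp.
pose ok (I : set algInt) := [/\ is_ideal I, I p%:R & ~ I 1].
have [|A [PA maxA]] := @Zorn_bigcup _ (fun I => I = set0 \/ ok I).
  move=> F FP tot; have [[I0 FI0 [x0 I0x0]]|none] := pselect (exists2 I, F I & exists x, I x); last first.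
    left; apply/seteqP; split=> // x [I FI Ix]; apply: none; exists I => //; by exists x.
  have okI I x : F I -> I x -> ok I by move=> FI Ix; case: (FP I FI) => // E; rewrite E in Ix.
  have okI0 := okI _ _ FI0 I0x0.
  right; split.
  - split.
    + by exists I0 => //; case: okI0 => -[].
    + move=> x y [I FI Ix] [J FJ Jy]; have [IJ|JI] := tot _ _ FI FJ.
        by exists J => //; have [[_ B _] _ _] := okI _ _ FJ Jy; apply: B => //; apply: IJ.
      by exists I => //; have [[_ B _] _ _] := okI _ _ FI Ix; apply: B => //; apply: JI.
    + by move=> u x [I FI Ix]; exists I => //; have [[_ _ M] _ _] := okI _ _ FI Ix; apply: M.
  - by exists I0 => //; case: okI0.
  - by case=> I FI I1; have [_ _] := okI _ _ FI I1; apply.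
have okp : ok [set y : algInt | exists x : algInt, y = p%:R * x]%classic.
  split.
  - split.
    + by exists 0; rewrite mulr0.
    + by move=> _ _ [x ->] [y ->]; exists (x - y); rewrite mulrBr.
    + by move=> u _ [x ->]; exists (u * x); rewrite mulrCA.
  - by exists 1; rewrite mulr1.
  - by case=> x /esym; apply: algInt_pchar_proper.
have okA : ok A.
  case: PA => // A0; exfalso; apply: (maxA _ _ (or_intror okp)); rewrite A0.
  by split=> // H; apply: (H 0); exists 0; rewrite mulr0.
have [idA Ap A1] := okA; have [A0 AB AM] := idA.
exists A; split=> // x Ax.
(* The ideal generated by A and x is strictly larger than A, so by maximality it contains 1. *)
pose J := [set y : algInt | exists u z : algInt, A z /\ y = z + u * x]%classic.
have idJ : is_ideal J.
  split.
  - by exists 0, 0; rewrite mul0r addr0.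
  - move=> _ _ [u [z [Az ->]]] [v [w [Aw ->]]]; exists (u - v), (z - w); split; first exact: AB.
    by rewrite mulrBl opprD addrACA.
  - move=> v _ [u [z [Az ->]]]; exists (v * u), (v * z); split; first exact: AM.
    by rewrite mulrDr mulrA.
have AJ : (A `<` J)%classic.
  split=> [z Az|H]; first by exists 0, z; rewrite mul0r addr0.
  by apply/Ax/H; exists 1, 0; rewrite mul1r add0r.
have J1 : J 1.
  apply: contrapT => J1; apply: (maxA J AJ); right; split=> //.
  by exists 0, p%:R; rewrite mul0r addr0.
by case: J1 => u [z [Az E]]; exists u; rewrite E addrK.
Qed.

Lemma residue_field p : prime p -> exists (k : fieldType) (phi : {rmorphism algInt -> k}),
  p \in [pchar k].
Proof.
move=> pp; have [I [idI Ip I1 Imax]] := maximal_ideal_exists pp; have [I0 IB IM] := idI.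
pose Ib : {pred algInt} := fun x => `[< I x >].
have IbP x : reflect (I x) (x \in Ib) by apply: asboolP.
have Ib_closed : idealr_closed Ib.
  split; [exact/IbP|by apply/IbP|].
  move=> u x y /IbP Ix /IbP Iy; apply/IbP; apply: is_idealD => //; exact: IM.
pose kI : idealr algInt := HB.pack_for (idealr algInt) Ib (isIdealr.Build algInt Ib Ib_closed).
pose Q := {ideal_quot kI}.
have piE (x y : algInt) : (\pi_Q x = \pi_Q y)%qT <-> I (x - y).
  by split=> [/eqP|h]; [rewrite -Quotient.idealrBE => /IbP|apply/eqP; rewrite -Quotient.idealrBE; apply/IbP].
have inv_ex (x : Q) : exists y : Q, x != 0 -> y * x = 1.
  have [->|x0] := eqVneq x 0; first by exists 0.
  elim/quotW: x x0 => a x0.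
  have Ia : ~ I a.
    move=> Ia; move/eqP: x0; apply.
    by rewrite -[0](rmorph0 (\pi_Q%qT : {rmorphism algInt -> Q})); apply/piE; rewrite subr0.
  have [u Iu] := Imax a Ia; exists (\pi_Q u)%qT => _.
  rewrite -(rmorphM (\pi_Q%qT : {rmorphism algInt -> Q})) -[1](rmorph1 (\pi_Q%qT : {rmorphism algInt -> Q})).
  by apply/esym/piE.
have /choice[inv0 invP] := inv_ex.
pose inv (x : Q) : Q := if x == 0 then 0 else inv0 x.
have mulVx (x : Q) : x != 0 -> inv x * x = 1 by move=> x0; rewrite /inv (negPf x0) invP.
have inv00 : inv 0 = 0 by rewrite /inv eqxx.
pose piR : {rmorphism algInt -> Q} := \pi_Q%qT.
have E : (\pi_Q (p%:R : algInt) = \pi_Q 0)%qT by apply/piE; rewrite subr0.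
have pQ : p%:R = 0 :> Q.
  transitivity (piR p%:R); first by rewrite rmorph_nat.
  transitivity (piR 0); [exact: E|exact: rmorph0].
pose k : fieldType := HB.pack_for fieldType Q (GRing.ComNzRing_isField.Build Q mulVx inv00).
exists k, (\pi_Q%qT : {rmorphism algInt -> Q}).
by rewrite inE pp; apply/eqP; exact: pQ.
Qed.

(* Psi = \prod_(s in G) (Y - \sum_i b (s i) X^i) has integer coefficients, so its reduction
   vanishes at the Frobenius image of the reduction of \sum_i b i X^i, one of its roots. *)
Lemma galR_frobenius d (b : 'I_d -> algInt) (k : fieldType) (phi : {rmorphism algInt -> k}) p :
  p \in [pchar k] -> injective b ->
  (forall nu : {rmorphism algC -> algC}, forall i, exists j, nu (algIntval (b i)) = algIntval (b j)) ->
  exists2 s, s \in galR (fun i => algIntval (b i)) & forall i, phi (b (s i)) = phi (b i) ^+ p.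
Proof.
move=> pch binj bconj; set G := galR _.
have rinj : injective (fun i => algIntval (b i)) by move=> i j /algIntval_inj/binj.
pose th (s : 'S_d) : {poly algInt} := \sum_i b (s i) *: 'X^i.
pose Psi : {poly {poly algInt}} := \prod_(s in G) ('X - (th s)%:P).
have thE (R : nzRingType) (f : {rmorphism algInt -> R}) (s : 'S_d) :
    map_poly f (th s) = \sum_i f (b (s i)) *: 'X^i.
  by rewrite rmorph_sum /=; apply: eq_bigr => i _; rewrite map_polyZ map_polyXn.
have PsiE (R : comNzRingType) (f : {rmorphism algInt -> R}) :
    map_poly (map_poly f) Psi = \prod_(s in G) ('X - (map_poly f (th s))%:P).
  by rewrite rmorph_prod /=; apply: eq_bigr => s _; rewrite rmorphB /= map_polyX map_polyC.
(* Every automorphism permutes the factors of Psi by a right translation of G, so the coefficients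
   are fixed, hence rational, and they are algebraic integers. *)
have Psi_int i j : exists n : int, Psi`_i`_j = n%:~R.
  suff : algIntval Psi`_i`_j \is a Num.int.
    case/intrP => n nE; exists n; apply: algIntval_inj; by rewrite nE rmorph_int.
  apply: Cint_rat_Aint (algIntvalP _); apply: fixed_Crat => nu.
  pose v : {rmorphism algInt -> algC} := algIntval.
  have [t tG tE] := perm_of_aut rinj (bconj nu).
  have cE : algIntval Psi`_i`_j = (map_poly (map_poly v) Psi)`_i`_j by rewrite !coef_map.
  have : map_poly (map_poly nu) (map_poly (map_poly v) Psi) = map_poly (map_poly v) Psi.
    rewrite PsiE rmorph_prod [RHS](reindex_inj (mulIg t)) /=.
    apply: eq_big => [s|s sG]; first by rewrite (groupMr _ (G := galR_group _)).
    rewrite rmorphB /= map_polyX map_polyC /= !thE rmorph_sum /=; congr (_ - _%:P).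
    by apply: eq_bigr => l _; rewrite map_polyZ map_polyXn /= permM -tE.
  by move/(congr1 (fun q : {poly {poly algC}} => q`_i`_j)); rewrite !coef_map /=.
pose F := pFrobenius_aut pch.
have PsiF : map_poly (map_poly F) (map_poly (map_poly phi) Psi) = map_poly (map_poly phi) Psi.
  apply/polyP => i; apply/polyP => j; rewrite !coef_map /=.
  by have [n ->] := Psi_int i j; rewrite !rmorph_int.
have root1 : (map_poly (map_poly phi) Psi).[map_poly phi (th 1%g)] = 0.
  rewrite PsiE horner_prod (bigD1 1%g) ?(group1 (galR_group _)) //=.
  by rewrite hornerXsubC subrr mul0r.
have : (map_poly (map_poly phi) Psi).[map_poly F (map_poly phi (th 1%g))] = 0.
  by rewrite -PsiF horner_map root1 rmorph0.
rewrite PsiE horner_prod => /eqP /prodf_eq0[s sG]; rewrite hornerXsubC subr_eq0 => /eqP E.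
exists s => // i; have := congr1 (fun q : {poly k} => q`_i) E.
rewrite coef_map !thE !coef_sum /=.
have S0 (c : 'I_d -> k) : \sum_(j < d) (c j *: 'X^j)`_i = c i.
  rewrite (bigD1 i) //= coefZ coefXn eqxx mulr1 big1 ?addr0 // => j ji.
  by rewrite coefZ coefXn [_ == _ :> nat]eq_sym (inj_eq val_inj) (negPf ji) mulr0.
by rewrite !S0 perm1 pFrobenius_autE => ->.
Qed.

(** X^p - X is the product of X - x over the elements x of F_p, so these account for all its roots
    in k. *)
Lemma pFrobenius_fixed_Fp p (k : fieldType) (io : {rmorphism 'F_p -> k}) (c : k) : prime p ->
  c ^+ p = c -> exists x, c = io x.
Proof.
move=> pp cp; have := congr1 (fun q => (map_poly io q).[c]) (@finField_genPoly 'F_p).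
rewrite card_Fp // rmorphB /= map_polyXn map_polyX rmorph_prod /= horner_prod.
rewrite hornerD hornerN hornerXn hornerX cp subrr => /esym/eqP/prodf_eq0[x _].
by rewrite rmorphB /= map_polyX map_polyC /= hornerXsubC subr_eq0 => /eqP ->; exists x.
Qed.

(** The product [f] of X - r l over the cycle of i under s is fixed by Frobenius, so it comes from
    F_p. It shares the root r i with the irreducible h, so h divides it, and every root of h lies in
    this cycle. *)
Lemma frobenius_trans d p (k : fieldType) (io : {rmorphism 'F_p -> k})
   (r : 'I_d -> k) (s : 'S_d) (h : {poly 'F_p}) :
  prime p -> injective r -> (forall i, r (s i) = r i ^+ p) -> irreducible_poly h ->
  forall i j, root (map_poly io h) (r i) -> root (map_poly io h) (r j) -> exists n, (s ^+ n)%g i = j.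
Proof.
move=> pp rinj rs [hs hirr] i j hi hj.
have pch : p \in [pchar k] by rewrite (fmorph_pchar io) pchar_Fp.
pose F := pFrobenius_aut pch.
pose f : {poly k} := \prod_(l in porbit s i) ('X - (r l)%:P).
have fF : map_poly F f = f.
  rewrite rmorph_prod [RHS](reindex_inj (@perm_inj _ s)) /=; apply: eq_big => l.
    by rewrite -!eq_porbit_mem -[s l]/((s ^+ 1)%g l) porbit_perm.
  by move=> _; rewrite rmorphB /= map_polyX map_polyC /= pFrobenius_autE rs.
have /fin_all_exists[x xE] : forall l : 'I_(size f), exists x, f`_l = io x.
  move=> l; apply: pFrobenius_fixed_Fp => //.
  by have := congr1 (fun q : {poly k} => q`_l) fF; rewrite coef_map /= pFrobenius_autE.
pose f0 : {poly 'F_p} := \poly_(l < size f) (if insub l is Some l' then x l' else 0).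
have f0E : map_poly io f0 = f.
  apply/polyP => l; rewrite coef_map coef_poly /=; case: ltnP => ls; last first.
    by rewrite rmorph0 nth_default.
  by rewrite insubT -xE.
have hf0 : h %| f0.
  have g1 : size (gcdp h f0) != 1%N.
    apply/negP => cop; have : coprimep (map_poly io h) (map_poly io f0) by rewrite coprimep_map.
    move/coprimep_root => /(_ _ hi); rewrite f0E => /eqP; apply.
    by rewrite horner_prod (bigD1 i) ?porbit_id //= hornerXsubC subrr mul0r.
  by have /andP[_ hg] := hirr _ g1 (dvdp_gcdl _ _); apply: dvdp_trans hg (dvdp_gcdr _ _).
have : root f (r j).
  by have /dvdpP[u E] := hf0; rewrite -f0E E rmorphM rootM hj orbT.
rewrite rootE horner_prod => /prodf_eq0[l lO]; rewrite hornerXsubC subr_eq0 => /eqP/rinj ->.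
by move: lO => /porbitP[n ->]; exists n.
Qed.

(** [h] is the minimal polynomial of a generator of the multiplicative group of the field with p^n
    elements. It is separable as a divisor of the product of all X - y. *)
Lemma irreducible_Fp_exists p n : prime p -> (0 < n)%N -> exists h : {poly 'F_p},
  [/\ irreducible_poly h, h \is monic, size h = n.+1, separable_poly h & h.[0] != 0].
Proof.
move=> pp n0; have [K pK cK] := pPrimePowerField pp n0.
pose L := pPrimeCharType pK.
have dimL : \dim {:L}%VS = n by rewrite pprimeChar_dimf cK pfactorK.
have /cyclicP[u uE] := field_unit_group_cyclic [set: {unit K}].
pose x : L := val u.
have genx : <<1; x>>%VS = {:L}%VS.
  apply/eqP; rewrite eqEsubv subvf /=; apply/subvP => y _.
  have [->|y0] := eqVneq y 0; first exact: mem0v.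
  have yu : (y : K) \is a GRing.unit by rewrite unitfE.
  have /cycleP[m mE] : FinRing.unit K yu \in <[u]>%g by rewrite -uE inE.
  have -> : y = x ^+ m.
    by have := congr1 val mE; rewrite /= -[LHS]/y => ->; elim: m {mE} => [|m IHm]; rewrite ?expg0 // expgS exprS /= IHm.
  by rewrite rpredX // memv_adjoin.
have /polyOver1P[h hE] := minPolyOver 1%AS x.
have hx : root (map_poly (in_alg L) h) x by rewrite -hE root_minPoly.
have hmon : h \is monic by rewrite -(map_monic (in_alg L)) -hE monic_minPoly.
have sh : size h = n.+1.
  rewrite -(size_map_poly (in_alg L)) -hE size_minPoly; congr _.+1.
  by rewrite adjoin_degreeE genx dimL dimv1 divn1.
have h0 : h != 0 by rewrite monic_neq0.
have hirr : irreducible_poly h.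
  split; first by rewrite sh.
  move=> q q1 qh.
  have /minPoly_irr : map_poly (in_alg L) q \is a polyOver 1%AS by apply/polyOver1P; exists q.
  move/(_ x); rewrite hE dvdp_map qh => /(_ isT).
  rewrite -(rmorph1 (map_poly (in_alg L))) !eqp_map => /orP[//|].
  by move/eqp_size; rewrite size_poly1 => E; rewrite E in q1.
exists h; split=> //.
- have : map_poly (in_alg L) h %| \prod_(y : L) ('X - y%:P).
    rewrite -finField_genPoly -hE; apply: minPoly_dvdp.
      by rewrite rpredB ?rpredX // polyOverX.
    by rewrite rootE hornerD hornerN hornerXn hornerX expf_card subrr.
  move/dvdp_separable => /(_ _); rewrite separable_map; apply.
  by rewrite -big_enum separable_prod_XsubC enum_uniq.
- apply/negP => h00.
  have : 'X - 0%:P %| h by rewrite dvdp_XsubCl.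
  move/(hirr.2 _); rewrite size_XsubC => /(_ isT).
  rewrite -(eqp_map (in_alg L)) => /eqp_root/(_ x); rewrite hx rmorphB /= map_polyX map_polyC /= scale0r.
  rewrite root_XsubC => /eqP x0; have := valP u; rewrite -[val u]/x x0.
  by rewrite unitr0.
Qed.

(** * Polynomials with one dominant coefficient *)

(* With k + 1 distinct roots z_i in the closed disk, a suitable combination u n = \sum_i w_i z_i^n
   would be a bounded solution of the recurrence given by c with u n = 0 for n < k and u k = 1;
   dominance of c k forces every bounded solution vanishing below k to be zero. *)
Lemma pellet_closed_disk d (c : 'I_d.+1 -> algC) (k : 'I_d.+1) (rs : seq algC) : uniq rs ->
  (forall z, z \in rs -> `|z| <= 1 /\ \sum_j c j * z ^+ j = 0) ->
  \sum_(j | j != k) `|c j| < `|c k| -> (size rs <= k)%N.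
Proof.
move=> urs rsP dom; rewrite leqNgt; apply/negP => krs.
pose z (i : 'I_k.+1) := rs`_i.
have zrs i : z i \in rs by apply: mem_nth; apply: leq_trans krs; apply: ltn_ord.
pose V := Vandermonde k.+1 (\row_i z i).
have Vu : V^T \in unitmx.
  rewrite unitmx_tr unitmxE det_Vandermonde unitfE; apply/prodf_neq0 => i _.
  apply/prodf_neq0 => j ij; rewrite !mxE subr_eq0 nth_uniq //; first by rewrite gtn_eqF.
    by apply: leq_trans krs; apply: ltn_ord.
  by apply: leq_trans krs; apply: ltn_ord.
(* The weights solve the Vandermonde system u n = 0 for n < k, u k = 1. *)
pose w : 'rV_k.+1 := delta_mx 0 ord_max *m invmx V^T.
pose u n := \sum_i w 0 i * z i ^+ n.
have uE (n : 'I_k.+1) : u n = (n == ord_max)%:R.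
  have : (w *m V^T) 0 n = (n == ord_max)%:R by rewrite mulmxKV // mxE eqxx.
  by rewrite mxE => <-; apply: eq_bigr => i _; rewrite !mxE.
have u0 n : (n < k)%N -> u n = 0.
  move=> nk; have := uE (Ordinal (leq_trans nk (leqnSn k))) => /= ->.
  by rewrite -val_eqE /= ltn_eqF.
have uk : u k = 1 by have := uE ord_max; rewrite eqxx.
have rec n : \sum_j c j * u (j + n)%N = 0.
  rewrite (eq_bigr (fun j => \sum_i w 0 i * z i ^+ n * (c j * z i ^+ j))) => [|j _].
    rewrite exchange_big big1 //= => i _; rewrite -mulr_sumr.
    by have [_ ->] := rsP _ (zrs i); rewrite mulr0.
  by rewrite mulr_sumr; apply: eq_bigr => i _; rewrite exprD; ring.
pose B := \sum_i `|w 0 i|.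
have B0 : 0 <= B by apply: sumr_ge0.
have uB n : `|u n| <= B.
  apply: le_trans (ler_norm_sum _ _ _) _; apply: ler_sum => i _.
  rewrite normrM ler_piMr // normrX exprn_ile1 //; exact: (rsP _ (zrs i)).1.
set S := \sum_(j | _) _ in dom.
have S0 : 0 <= S by apply: sumr_ge0.
have ck0 : 0 < `|c k| by apply: le_lt_trans dom.
pose th := S / `|c k|.
have th0 : 0 <= th by rewrite divr_ge0 // ltW.
have th1 : th < 1 by rewrite ltr_pdivrMr // mul1r.
(* Solving the recurrence for its dominant term gains a factor [th] < 1 on any uniform bound for
   u. *)
have step t n : `|u n| <= th ^+ t * B.
  elim: t n => [|t IHt] n; first by rewrite expr0 mul1r.
  have [nk|kn] := ltnP n k; first by rewrite u0 // normr0 mulr_ge0 ?exprn_ge0.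
  have := rec (n - k)%N; rewrite (bigD1 k) //= subnKC // => /eqP; rewrite addr_eq0 => /eqP E.
  rewrite -(ler_pM2l ck0) -normrM E normrN.
  apply: le_trans (ler_norm_sum _ _ _) _.
  have -> : `|c k| * (th ^+ t.+1 * B) = S * (th ^+ t * B).
    by rewrite exprS /th; field; rewrite gt_eqF.
  by rewrite mulr_suml; apply: ler_sum => j _; rewrite normrM ler_wpM2l.
pose e := 1 - th.
have e0 : 0 < e by rewrite subr_gt0.
(* A Bernoulli inequality: with u k = 1 it turns the geometric decay into 1 + t e <= B for all t,
   against the Archimedean property. *)
have bern t : th ^+ t * (1 + t%:R * e) <= 1.
  elim: t => [|t IHt]; first by rewrite expr0 mul0r addr0 mulr1.
  apply: le_trans IHt; rewrite exprSr -mulrA ler_wpM2l ?exprn_ge0 //.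
  have -> : th * (1 + t.+1%:R * e) = 1 + t%:R * e - t.+1%:R * e ^+ 2.
    by rewrite /e -natr1; ring.
  by rewrite gerBl mulr_ge0 // exprn_ge0 // ltW.
have big t : 1 + t%:R * e <= B.
  apply: (@le_trans _ _ (th ^+ t * B * (1 + t%:R * e))).
    rewrite ler_peMl ?addr_ge0 ?mulr_ge0 ?(ltW e0) //.
    by have := step t k; rewrite uk normr1.
  by rewrite mulrAC ler_piMl.
have Be0 : 0 <= B / e by rewrite divr_ge0 // ltW.
have := archi_boundP Be0; rewrite ltr_pdivrMr // => lt.
have h : (Num.bound (B / e))%:R * e <= B by apply: le_trans (big (Num.bound (B / e))); rewrite lerDr ler01.
by have := lt_le_trans lt h; rewrite ltxx.
Qed.

(** The previous bound gives at most k roots inside; applied to the reversed polynomial, whose roots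
    are the inverses, it gives at most d - k roots outside. The total is d, so both are
    equalities. *)
Lemma pellet d (c : 'I_d.+1 -> algC) (k : 'I_d.+1) (r : 'I_d -> algC) : injective r ->
  (forall i, \sum_j c j * r i ^+ j = 0) ->
  \sum_(j | j != k) `|c j| < `|c k| ->
  #|[set i | `|r i| < 1]| = k /\ #|[set i | 1 <= `|r i|]| = (d - k)%N.
Proof.
move=> rinj rP dom.
set In := [set i | `|r i| < 1]; set Out := [set i | 1 <= `|r i|].
have le1 : (#|In| <= k)%N.
  rewrite cardE -(size_map r); apply: (pellet_closed_disk (c := c)) dom.
    by rewrite map_inj_uniq ?enum_uniq.
  by move=> z /mapP[i]; rewrite mem_enum inE => /ltW ri ->.
have le2 : (#|Out| <= d - k)%N.
  have -> : (d - k)%N = rev_ord k by rewrite /= subSS.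
  rewrite cardE -(size_map (fun i => (r i)^-1)).
  apply: (pellet_closed_disk (c := fun j => c (rev_ord j))).
  - by rewrite map_inj_uniq ?enum_uniq // => i j /invr_inj/rinj.
  - move=> z /mapP[i]; rewrite mem_enum inE => ri ->.
    have r0 : r i != 0 by rewrite -normr_gt0; apply: lt_le_trans ri.
    split; first by rewrite normfV invf_le1 // normr_gt0.
    apply: (@mulfI _ (r i ^+ d)); first by rewrite expf_neq0.
    rewrite mulr0 -[RHS](rP i) mulr_sumr [RHS](reindex_inj rev_ord_inj) /=; apply: eq_bigr => j _.
    rewrite mulrCA exprVn; congr (_ * _).
    have jd : (j <= d)%N by rewrite -ltnS.
    by rewrite subSS expfB_cond // (negPf r0).
  - rewrite rev_ordK; apply: le_lt_trans dom.
    rewrite [leRHS](reindex_inj rev_ord_inj) /= le_eqVlt; apply/orP; left; apply/eqP.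
    by apply: eq_bigl => j; rewrite -(inj_eq rev_ord_inj) rev_ordK.
have tot : (#|In| + #|Out| = d)%N.
  have -> : Out = ~: In.
    by apply/setP => i; rewrite !inE real_leNgt ?normr_real.
  by rewrite cardsC card_ord.
have := ltn_ord k; lia.
Qed.

(** * A family with doubly transitive Galois groups *)

Lemma coef_prod_scale (a : algC) (s : seq algC) j :
  (\prod_(z <- s) ('X - (a * z)%:P))`_j * a ^+ j = a ^+ (size s) * (\prod_(z <- s) ('X - z%:P))`_j.
Proof.
elim: s j => [|z s IHs] j.
  by rewrite !big_nil expr0 mul1r coefC; case: j => [|j]; rewrite ?expr0 ?mulr1 ?mul0r.
rewrite !big_cons !mulrBl !coefB !['X * _]mulrC !coefMX !coefCM /=.
case: j => [|j] /=; first by rewrite !sub0r mulNr -mulrA IHs exprS; ring.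
by rewrite mulrBl exprSr mulrA IHs -!mulrA -exprSr IHs exprS; ring.
Qed.

(** The roots of the monic Q are algebraic integers, and separability mod p keeps their images in a
    residue field distinct. So they are distinct themselves, and a Frobenius element acts on their
    indices. *)
Lemma frobenius_mod p d (Q : {poly int}) (r : 'I_d -> algC) : prime p ->
  map_poly intr Q = \prod_i ('X - (r i)%:P) ->
  separable_poly (map_poly intr Q : {poly 'F_p}) ->
  injective r /\ exists (k : fieldType) (io : {rmorphism 'F_p -> k}) (rk : 'I_d -> k) (s : 'S_d),
    [/\ s \in galR r, injective rk, forall i, rk (s i) = rk i ^+ p &
      map_poly io (map_poly intr Q) = \prod_i ('X - (rk i)%:P)].
Proof.
move=> pp QE Qsep; have [k0 [phi0 pk]] := residue_field pp.
pose k : fieldType := pPrimeCharType pk; pose phi : {rmorphism algInt -> k} := phi0.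
pose io : {rmorphism 'F_p -> k} := in_alg (pPrimeCharType pk).
have Qmon : (map_poly intr Q : {poly algC}) \is monic by rewrite QE monic_prod_XsubC.
have rA i : r i \in Aint.
  apply: (root_monic_Aint (p := map_poly intr Q)) => //.
    by rewrite QE rootE horner_prod (bigD1 i) //= hornerXsubC subrr mul0r.
  by apply/polyOverP => j; rewrite coef_map intr_int.
pose b i := AlgInt (rA i); pose rk i := phi (b i).
have bQ : \prod_i ('X - (b i)%:P) = map_poly intr Q.
  apply: (map_inj_poly algIntval_inj) => //.
  rewrite rmorph_prod -map_poly_comp /= (eq_bigr (fun i => 'X - (r i)%:P)) => [|i _].
    by rewrite -QE; apply: eq_map_poly => n /=; rewrite rmorph_int.
  by rewrite rmorphB /= map_polyX map_polyC.
have kQ : map_poly io (map_poly intr Q) = \prod_i ('X - (rk i)%:P).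
  have -> : \prod_i ('X - (rk i)%:P) = map_poly phi (\prod_i ('X - (b i)%:P)).
    by rewrite rmorph_prod; apply: eq_bigr => i _; rewrite rmorphB /= map_polyX map_polyC.
  rewrite bQ -!map_poly_comp; apply: eq_map_poly => n.
  transitivity (n%:~R : k); [exact: (rmorph_int io)|exact/esym/(rmorph_int phi)].
have rkinj : injective rk.
  have : separable_poly (\prod_i ('X - (rk i)%:P)) by rewrite -kQ separable_map.
  have -> : \prod_i ('X - (rk i)%:P) = \prod_(z <- map rk (enum 'I_d)) ('X - z%:P).
    by rewrite big_map big_enum.
  by rewrite separable_prod_XsubC => /injectiveP.
have binj : injective b by move=> i j bij; apply: rkinj; rewrite /rk bij.
have rinj : injective r by move=> i j rij; apply: binj; apply: val_inj.
split=> //.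
have [|s sG sE] := galR_frobenius phi pk binj.
  move=> nu i; have : root (map_poly intr Q) (nu (r i)).
    have -> : map_poly intr Q = map_poly nu (map_poly intr Q) :> {poly algC}.
      by rewrite -map_poly_comp; apply: eq_map_poly => n /=; rewrite rmorph_int.
    by rewrite fmorph_root QE rootE horner_prod (bigD1 i) //= hornerXsubC subrr mul0r.
  rewrite QE rootE horner_prod => /prodf_eq0[j _]; rewrite hornerXsubC subr_eq0 => /eqP ->.
  by exists j.
by exists k, io, rk, s; split.
Qed.

(* The polynomial a^(d-1) P(X / a), with a the leading coefficient of P: its roots are a times
   those of P, and it agrees with P modulo any p with a = 1 mod p. *)
Definition monicize d (P : {poly int}) : {poly int} :=
  \poly_(j < d.+1) (if j == d then 1 else lead_coef P ^+ (d.-1 - j) * P`_j).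

Lemma monicize_modp p d (P : {poly int}) : prime p -> size P = d.+1 ->
  (lead_coef P)%:~R = 1 :> 'F_p -> map_poly intr (monicize d P) = map_poly intr P :> {poly 'F_p}.
Proof.
move=> pp sP lP; apply/polyP => j; rewrite !coef_map coef_poly /=.
case: ltnP => jd; last by rewrite [P`__]nth_default ?sP.
case: eqP => [->|_]; last by rewrite rmorphM rmorphXn /= lP expr1n mul1r.
by have := lP; rewrite lead_coefE sP => ->.
Qed.

Lemma monicize_roots d (P : {poly int}) (s : seq algC) : (0 < d)%N -> size P = d.+1 ->
  map_poly intr P = (lead_coef P)%:~R *: \prod_(z <- s) ('X - z%:P) -> size s = d ->
  map_poly intr (monicize d P) = \prod_(z <- s) ('X - ((lead_coef P)%:~R * z)%:P).
Proof.
move=> d0 sP PE ss; set a : algC := (lead_coef P)%:~R.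
have a0 : a != 0 by rewrite intr_eq0 lead_coef_eq0 -size_poly_eq0 sP.
apply/polyP => j; apply: (@mulIf _ (a ^+ j)); first by rewrite expf_neq0.
rewrite coef_prod_scale ss coef_map coef_poly /=.
have Pj : (P`_j)%:~R = a * (\prod_(z <- s) ('X - z%:P))`_j.
  by have := congr1 (fun q : {poly algC} => q`_j) PE; rewrite coef_map coefZ /=.
case: ltnP => jd; last first.
  by rewrite mul0r nth_default ?mulr0 // size_prod_XsubC ss.
case: eqP => [->|/eqP jd'].
  have := monicP (monic_prod_XsubC s xpredT id); rewrite lead_coefE size_prod_XsubC ss /= => ->.
  by rewrite mul1r mulr1.
rewrite rmorphM rmorphXn /= Pj -/a mulrAC -exprD mulrCA mulrA -exprS.
by congr (_ ^+ _ * _); lia.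
Qed.

(** The Frobenius element [g2] at 2 is transitive on the roots, so P is irreducible up to its
    content. The element [g3] at 3 fixes the root reducing to 0 and is transitive on the others,
    which gives the spanning condition for every proper nonempty S. *)
Lemma galois_family d (P : {poly int}) (h2 : {poly 'F_2}) (h3 : {poly 'F_3}) (a : algC) :
  (1 < d)%N -> size P = d.+1 -> 0 < lead_coef P ->
  map_poly intr P = h2 -> irreducible_poly h2 -> size h2 = d.+1 -> h2 \is monic -> separable_poly h2 ->
  map_poly intr P = 'X * h3 -> irreducible_poly h3 -> size h3 = d -> h3 \is monic -> separable_poly h3 -> h3.[0] != 0 ->
  root (map_poly intr P) a ->
  [/\ degA a = d, P = zcontents P *: minZpoly a
    & forall S : {set 'I_d}, (0 < #|S| < d)%N -> spans (galR (root_of d a)) S].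
Proof.
move=> d1 sP lP P2 i2 z2 m2 s2 P3 i3 z3 m3 s3 h30 Pa.
have [s sE] := closed_field_poly_normal (map_poly intr P : {poly algC}).
have intr0 : injective (intr : int -> algC) by exact: intr_inj.
have lc : lead_coef (map_poly intr P : {poly algC}) = (lead_coef P)%:~R.
  by rewrite lead_coef_map_inj.
rewrite lc in sE.
have l0 : (lead_coef P)%:~R != 0 :> algC by rewrite intr_eq0 gt_eqF.
have ss : size s = d.
  have := congr1 (fun q : {poly algC} => size q) sE; rewrite size_scale // size_prod_XsubC.
  by rewrite size_map_inj_poly // sP => -[].
pose rho (i : 'I_d) : algC := s`_i; pose r i := (lead_coef P)%:~R * rho i.
have QE : map_poly intr (monicize d P) = \prod_i ('X - (r i)%:P).
  rewrite (monicize_roots _ sP sE ss) ?(ltnW d1) // (big_nth 0) ss big_mkord.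
  by apply: eq_bigr => i _.
have lmod p : prime p -> (map_poly intr P : {poly 'F_p}) \is monic ->
    size (map_poly intr P : {poly 'F_p}) = d.+1 -> (lead_coef P)%:~R = 1 :> 'F_p.
  by move=> pp /monicP; rewrite !lead_coefE sP => mP sP'; rewrite sP' coef_map in mP.
have lm2 : (lead_coef P)%:~R = 1 :> 'F_2 by apply: lmod; rewrite ?P2.
have lm3 : (lead_coef P)%:~R = 1 :> 'F_3.
  by apply: lmod; rewrite ?P3 ?monicMl ?monicX // mulrC size_mulX ?monic_neq0 // z3.
have Q2 := monicize_modp (isT : prime 2) sP lm2; have Q3 := monicize_modp (isT : prime 3) sP lm3.
have [|rinj [k2 [io2 [r2 [g2 [g2G r2inj r2E h2E]]]]]] := frobenius_mod (isT : prime 2) QE.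
  by rewrite Q2 P2.
have [|_ [k3 [io3 [r3 [g3 [g3G r3inj r3E h3E]]]]]] := frobenius_mod (isT : prime 3) QE.
  have XE : 'X = 'X - 0%:P :> {poly 'F_3} by rewrite polyC0 subr0.
  by rewrite Q3 P3 mulrC XE separable_root s3 rootE.
rewrite Q2 P2 in h2E; rewrite Q3 P3 in h3E.
have root2 i : root (map_poly io2 h2) (r2 i).
  by rewrite h2E rootE horner_prod (bigD1 i) //= hornerXsubC subrr mul0r.
have tr2 i j : exists n, (g2 ^+ n)%g i = j.
  exact: (frobenius_trans (isT : prime 2) r2inj r2E i2 (root2 i) (root2 j)).
have as_ : a \in s by move: Pa; rewrite sE rootZ // root_prod_XsubC.
have [i0 ai0] : exists i0, a = rho i0.
  have li : (index a s < d)%N by rewrite -ss index_mem.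
  by exists (Ordinal li); rewrite /rho /= nth_index.
have rhoinj : injective rho by move=> i j ij; apply: rinj; rewrite /r ij.
have us : uniq s.
  apply/(uniqP 0) => i j; rewrite !inE ss => li lj ij.
  by have /(congr1 val) := rhoinj (Ordinal li) (Ordinal lj) ij.
have conj_rho (nu : {rmorphism algC -> algC}) i j : nu (r i) = r j -> nu (rho i) = rho j.
  by rewrite /r rmorphM rmorph_int => /(mulfI l0).
have rho_min i : root (minCpoly a) (rho i).
  have [n nE] := tr2 i0 i.
  have /galRP[nu nuE] : (g2 ^+ n)%g \in galR r by rewrite (groupX _ (G := galR_group r)).
  rewrite ai0 -(minCpoly_aut nu) (conj_rho nu i0 i) ?root_minCpoly //.
  by rewrite nuE nE.
have PS : perm_eq s (conjs a).
  apply: uniq_perm (uniq_conjs a) _ => // z; apply/idP/idP.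
    by move=> /(nthP 0)[i]; rewrite ss mem_conjs => li <-; apply: (rho_min (Ordinal li)).
  rewrite mem_conjs => /algC_conj_aut[nu <-].
  have : root (map_poly intr P) (nu a).
    have -> : map_poly intr P = map_poly nu (map_poly intr P) :> {poly algC}.
      by rewrite -map_poly_comp; apply: eq_map_poly => n /=; rewrite rmorph_int.
    by rewrite fmorph_root.
  by rewrite sE rootZ // root_prod_XsubC.
have da : degA a = d by rewrite -size_conjs -(perm_size PS).
have [la0 zE zc] := minZpoly_spec a.
split=> //.
  (* Both sides have the same roots and leading coefficient. Comparing contents then identifies
     [lead_coef P] as [lead0 a] times the content of P. *)
  have E1 : lead0 a *: P = lead_coef P *: minZpoly a.
    apply: (map_inj_poly intr0) => //; rewrite !map_polyZ /= zE sE conjsE (perm_big _ PS) /=.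
    by rewrite !scalerA mulrC.
  have := congr1 zcontents E1; rewrite !zcontentsZ zc mulr1 => lE.
  have la0' : lead0 a != 0 by rewrite gt_eqF.
  apply/polyP => j; apply: (mulfI la0').
  by rewrite [in RHS]coefZ mulrA lE -[RHS]coefZ -E1 coefZ.
move=> S Sd.
have /fin_all_exists[t tE] i : exists j, rho i = root_of d a j by apply: root_ofP.
have tinj : injective t by move=> i j ij; apply: rhoinj; rewrite !tE ij.
(* [tau] passes from the numbering of the roots along [s] to the one along [conjs a]; [g3] becomes
   its conjugate by [tau]. *)
pose tau := perm tinj.
have tauE i : rho i = root_of d a (tau i) by rewrite permE.
have [f rf] : exists f, r3 f = 0.
  have : (map_poly io3 ('X * h3)).[0] = 0 by rewrite rmorphM hornerM /= map_polyX hornerX mul0r.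
  rewrite h3E horner_prod => /eqP/prodf_eq0[f _]; rewrite hornerXsubC sub0r oppr_eq0 => /eqP; by exists f.
have root3 i : i != f -> root (map_poly io3 h3) (r3 i).
  move=> fi; have : root (map_poly io3 ('X * h3)) (r3 i).
    by rewrite h3E rootE horner_prod (bigD1 i) //= hornerXsubC subrr mul0r.
  by rewrite rmorphM rootM /= map_polyX rootX -rf (inj_eq r3inj) (negPf fi).
have tauK i : tau ((tau^-1)%g i) = i by rewrite permKV.
apply: (spans_fixpt (G := galR_group (root_of d a)) (g := (g3 ^ tau)%g) (f := tau f)) => //.
- by move=> i j; have [g gG gE] := galR_trans i j da; exists g.
- have /galRP[nu nuE] := g3G; apply/galRP; exists nu => i.
  by rewrite -[i]tauK permJ -!tauE; apply: conj_rho.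
- by rewrite permJ; congr (tau _); apply: r3inj; rewrite r3E rf expr0n.
- move=> i j; rewrite -[i]tauK -[j]tauK !(inj_eq perm_inj) => fi fj.
  have [n nE] := frobenius_trans (isT : prime 3) r3inj r3E i3 (root3 _ fi) (root3 _ fj).
  by exists n; rewrite -conjXg permJ nE.
Qed.

Lemma crt23 (x : 'F_2) (y : 'F_3) : exists n, [/\ (n < 6)%N, n%:R = x :> 'F_2 & n%:R = y :> 'F_3].
Proof.
exists (chinese 2 3 x y %% 6)%N; split; first by rewrite ltn_mod.
- apply: val_inj; rewrite /= val_Fp_nat //.
  by rewrite (modn_dvdm _ (isT : 2 %| 6)%N) chinese_modl // modn_small // ltn_ord.
- apply: val_inj; rewrite /= val_Fp_nat //.
  by rewrite (modn_dvdm _ (isT : 3 %| 6)%N) chinese_modr // modn_small // ltn_ord.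
Qed.

(** [h3] has degree d - 1, so that [h2] and X [h3] are both monic of degree d and can be imposed
    together modulo 6. *)
Lemma residues_exist d : (1 < d)%N -> exists (r : nat -> nat) (h2 : {poly 'F_2}) (h3 : {poly 'F_3}),
  [/\ forall j, (r j < 6)%N, forall j, (r j)%:R = h2`_j & forall j, (r j)%:R = ('X * h3)`_j]
  /\ [/\ irreducible_poly h2, size h2 = d.+1, h2 \is monic & separable_poly h2]
  /\ [/\ irreducible_poly h3, size h3 = d, h3 \is monic, separable_poly h3 & h3.[0] != 0].
Proof.
move=> d1; have [h2 [i2 m2 z2 s2 _]] := @irreducible_Fp_exists 2 d isT (ltnW d1).
have d0 : (0 < d.-1)%N by lia.
have [h3 [i3 m3 z3 s3 h30]] := @irreducible_Fp_exists 3 d.-1 isT d0.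
have /choice[r rP] := fun j => crt23 h2`_j ('X * h3)`_j.
exists r, h2, h3; split; first by split=> j; have [] := rP j.
by rewrite z3 prednK ?(ltnW d1).
Qed.

Lemma cauchy_root_bound d (c : 'I_d.+1 -> algC) (z : algC) (A B : algC) : 0 < A -> 0 <= B ->
  (forall j, `|c j| <= B) -> A <= `|c ord_max| -> \sum_j c j * z ^+ j = 0 ->
  1 <= `|z| -> `|z| <= d%:R * B / A.
Proof.
move=> A0 B0 cB cA cz z1.
have z0 : 0 < `|z| by apply: lt_le_trans z1.
move: cz; rewrite big_ord_recr /= => /eqP; rewrite addrC addr_eq0 => /eqP E.
case: d c cB cA E => [|d] c cB cA E.
  move: E; rewrite big_ord0 oppr0 expr0 mulr1 => c0.
  by move: cA; rewrite c0 normr0 => /(lt_le_trans A0); rewrite ltxx.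
rewrite ler_pdivlMr // mulrC -(ler_pM2r (exprn_gt0 d z0)) -mulrA -exprS.
apply: (@le_trans _ _ (`|c ord_max| * `|z| ^+ d.+1)).
  by rewrite ler_wpM2r // exprn_ge0 // ltW.
rewrite -normrX -normrM E normrN.
apply: le_trans (ler_norm_sum _ _ _) _.
rewrite -mulrA mulr_natl -[X in _ *+ X]card_ord -sumr_const; apply: ler_sum => j _.
rewrite normrM normrX ler_pM ?exprn_ge0 //.
by rewrite ler_weXn2l // -ltnS.
Qed.

Lemma family_exists d k : (1 < d)%N -> (0 < k < d)%N -> exists2 C : nat, (0 < C)%N &
  forall N, (0 < N)%N -> exists (P : {ffun 'I_d.+1 -> 'I_N} -> {poly int}) (al : {ffun 'I_d.+1 -> 'I_N} -> algC),
  injective P /\ forall t,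
   [/\ degA (al t) = d, n_in_disk (al t) = k, mahler (al t) <= (C * N)%:R & good d (al t)]
   /\ [/\ 0 < zcontents (P t), P t = zcontents (P t) *: minZpoly (al t), size (P t) = d.+1 &
     forall j : 'I_d.+1, 0 < (P t)`_j <= (C * N)%:Z].
Proof.
move=> d1 /andP[k0 kd]; have [r [h2 [h3 [[r6 rh2 rh3] [[i2 z2 m2 s2] [i3 z3 m3 s3 h30]]]]]] := residues_exist d1.
(* The leading coefficient is at most 12 (d + 1) N, and each of the d roots has absolute value at
   most d (24 d N) / (6 N) = 4 d^2. *)
exists (12 * d.+1 * (4 * d * d) ^ d)%N => [|N N0].
  by rewrite !muln_gt0 expn_gt0 !muln_gt0 /= (ltnW d1).
(* Without the last term every coefficient lies between 6 N and 12 N. The term 12 d N makes the k-th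
   one exceed the sum of the d others and does not change residues mod 6. *)
pose cf (t : {ffun 'I_d.+1 -> 'I_N}) (j : 'I_d.+1) := (r j + 6 * (N + t j) + (val j == k) * (12 * d * N))%N.
pose P t := \poly_(j < d.+1) (cf t (inord j))%:Z.
have PE t (j : 'I_d.+1) : (P t)`_j = (cf t j)%:Z by rewrite coef_poly ltn_ord inord_val.
have cf_lo t j : (6 * N <= cf t j)%N.
  by apply: (@leq_trans (r j + 6 * (N + t j))%N); [lia|apply: leq_addr].
have cfE t j : cf t j = (r j + 6 * (N + t j + (val j == k) * (2 * d * N)))%N.
  by rewrite /cf; ring.
have cf_hi t j : (cf t j <= 12 * N + (val j == k) * (12 * d * N))%N.
  by rewrite /cf leq_add2r; have := r6 j; have := ltn_ord (t j); lia.
have cf_gt0 t j : (0 < cf t j)%N by apply: leq_trans (cf_lo t j); lia.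
have sP t : size (P t) = d.+1.
  by apply: size_poly_eq; rewrite -[d]/(val (@ord_max d)) inord_val; have := cf_gt0 t ord_max; lia.
have lP t : lead_coef (P t) = (cf t ord_max)%:Z by rewrite lead_coefE sP -PE.
have lP0 t : 0 < lead_coef (P t) by rewrite lP; have := cf_gt0 t ord_max; lia.
have P2 t : map_poly intr (P t) = h2.
  apply/polyP => j; rewrite coef_map /=; have [jd|jd] := ltnP j d.+1; last first.
    by rewrite !nth_default ?sP ?z2 // rmorph0.
  rewrite (PE t (Ordinal jd)) -rh2 cfE -pmulrn natrD natrM (_ : 6%:R = 0 :> 'F_2) ?mul0r ?addr0 //.
  exact: val_inj.
have P3 t : map_poly intr (P t) = 'X * h3.
  apply/polyP => j; rewrite coef_map /=; have [jd|jd] := ltnP j d.+1; last first.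
    rewrite !nth_default ?sP // ?rmorph0 //.
    by rewrite mulrC size_mulX ?z3 // monic_neq0.
  rewrite (PE t (Ordinal jd)) -rh3 cfE -pmulrn natrD natrM (_ : 6%:R = 0 :> 'F_3) ?mul0r ?addr0 //.
  exact: val_inj.
have intr0 : injective (intr : int -> algC) by exact: intr_inj.
have /choice[al alP] : forall t, exists a : algC, root (map_poly intr (P t)) a.
  by move=> t; apply/closed_rootP; rewrite size_map_inj_poly ?sP // eqSS -lt0n (ltnW d1).
exists P, al; split.
  move=> t u tu; apply/ffunP => j; apply: val_inj.
  by have := congr1 (fun q : {poly int} => q`_j) tu; rewrite !PE /cf => -[] /eqP; rewrite eqn_add2r eqn_add2l eqn_pmul2l // eqn_add2l => /eqP.
move=> t; have [da Pc sp] := galois_family d1 (sP t) (lP0 t) (P2 t) i2 z2 m2 s2 (P3 t) i3 z3 m3 s3 h30 (alP t).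
have c0 : 0 < zcontents (P t) by rewrite -sgz_gt0 sgz_contents sgz_gt0.
have rP (i : 'I_d) : \sum_j ((cf t j)%:R : algC) * root_of d (al t) i ^+ j = 0.
  have : root (map_poly intr (P t)) (root_of d (al t) i).
    rewrite Pc map_polyZ rootZ ?intr_eq0 ?gt_eqF //.
    have [la0 -> _] := minZpoly_spec (al t).
    by rewrite rootZ ?intr_eq0 ?gt_eqF // root_root_of.
  rewrite rootE horner_coef size_map_inj_poly // sP => /eqP E.
  by rewrite -[RHS]E; apply: eq_bigr => j _; rewrite coef_map PE /=.
have kd' : (k < d.+1)%N by rewrite ltnS ltnW.
pose ko : 'I_d.+1 := Ordinal kd'.
have dom : \sum_(j | j != ko) `|(cf t j)%:R| < `|(cf t ko)%:R| :> algC.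
  under eq_bigr do rewrite normr_nat.
  rewrite normr_nat -natr_sum ltr_nat.
  apply: (@leq_ltn_trans (\sum_(j < d.+1 | j != ko) 12 * N)%N).
    by apply: leq_sum => j jk; have := cf_hi t j; rewrite -val_eqE /= in jk; rewrite (negPf jk); lia.
  rewrite sum_nat_const (_ : #|_| = d)%N; last by rewrite cardC1 card_ord.
  by rewrite /cf eqxx; lia.
have [_ out] := pellet (root_of_inj da) rP dom.
have nk : n_in_disk (al t) = k.
  have := card_outS da; rewrite (_ : #|outS d (al t)| = d - k)%N; first by lia.
  exact: out.
have S0d : (0 < #|outS d (al t)| < d)%N by have := card_outS da; rewrite nk; lia.
split; split=> //; last first.
  move=> j; rewrite PE; apply/andP; split; first by have := cf_gt0 t j; lia.
  rewrite lez_nat; apply: leq_trans (cf_hi t j) _.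
  apply: (@leq_trans (12 * d.+1 * N)%N); first by case: (_ == _); nia.
  by rewrite leq_mul2r; apply/orP; right; rewrite leq_pmulr // expn_gt0 !muln_gt0 /= (ltnW d1).
- exact: sp.
rewrite /mahler.
have l_le : (lead0 (al t))%:~R <= (12 * d.+1 * N)%:R :> algC.
  have lE : lead_coef (P t) = zcontents (P t) * lead0 (al t) by rewrite {1}Pc lead_coefZ.
  have l1 : (lead0 (al t) <= lead_coef (P t)).
    by rewrite lE ler_peMl ?(ltW (lead0_gt0 _)).
  rewrite -[(12 * _ * _)%:R]/((12 * d.+1 * N)%:Z%:~R) ler_int; apply: le_trans l1 _.
  rewrite lP lez_nat; apply: leq_trans (cf_hi t _) _; by case: (_ == _); nia.
have -> : (12 * d.+1 * (4 * d * d) ^ d * N)%N = (12 * d.+1 * N * (4 * d * d) ^ d)%N by ring.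
rewrite natrM ler_pM ?prodr_ge0 ?ler0z ?(ltW (lead0_gt0 _)) //.
rewrite (big_conjs (d := d)) //= natrX -[X in _ ^+ X]card_ord -prodr_const.
apply: ler_prod => i _; rewrite /Order.max.
case: (real_ltP (real1 algC) (normr_real (root_of d (al t) i))) => h; rewrite ?ler01 ?normr_ge0 /=; last first.
  by rewrite -[leLHS]/(1%:R) ler_nat !muln_gt0 (ltnW d1).
have N0' : 0 < (6 * N)%:R :> algC by rewrite ltr0n; lia.
have B0 : 0 <= (24 * d * N)%:R :> algC by [].
have := @cauchy_root_bound d (fun j => (cf t j)%:R) (root_of d (al t) i) (6 * N)%:R (24 * d * N)%:R N0' B0.
rewrite !normr_nat !ler_nat => /(_ _ (cf_lo t _) (rP i) (ltW h)) H.
apply: le_trans (H _) _ => [j|].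
  rewrite normr_nat ler_nat; apply: leq_trans (cf_hi t j) _.
  apply: (@leq_trans (12 * N + 12 * d * N)%N).
    by rewrite leq_add2l; case: (_ == _); rewrite ?mul1n ?mul0n.
  rewrite (_ : 24 * d * N = 12 * d * N + 12 * d * N)%N; last by ring.
  by rewrite leq_add2r -mulnA leq_mul2l /= leq_pmull // ltnW.
by rewrite ler_pdivrMr // -!natrM ler_nat; apply: eq_leq; ring.
Qed.

(** * Counting Mahler measures *)

(** The exponent is at least 2, so each term is at most X^(e+2) / ((i - 1) i), and the sum of 1 / (i
    - 1) - 1 / i telescopes to at most 1 / (T - 1). *)
Lemma sum_div_pow_bound (X e T : nat) : (1 < T)%N ->
  (\sum_(T <= i < X.+1) (X %/ i) ^ e.+2 * T.-1 <= X ^ e.+2)%N.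
Proof.
move=> T1; have [TX|TX] := leqP T X.+1; last by rewrite big_geq // ltnW.
rewrite -big_distrl /= -(ler_nat rat) natrM natr_sum.
have T0 : 0 < T.-1%:R :> rat by rewrite ltr0n; lia.
rewrite -ler_pdivlMr //.
pose g (i : nat) : rat := (X ^ e.+2)%:R / i%:R.
apply: (@le_trans _ _ (\sum_(T <= i < X.+1) (g i.-1 - g i))).
  apply: ler_sum_nat => i /andP[Ti iX].
  have i0 : (0 < i.-1)%N by lia.
  have -> : g i.-1 - g i = (X ^ e.+2)%:R / (i.-1%:R * i%:R).
    rewrite /g -[in X in _ / X - _](prednK (ltnW (leq_trans T1 Ti))).
    have -> : i%:R = i.-1%:R + 1 :> rat by rewrite natr1 prednK //; lia.
    field; rewrite natr1 !pnatr_eq0; lia.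
  rewrite ler_pdivlMr; last by rewrite mulr_gt0 ?ltr0n; lia.
  rewrite -!natrM ler_nat.
  apply: (@leq_trans ((X %/ i * i) ^ e.+2)); last first.
    by rewrite leq_expn2r // leq_trunc_div.
  rewrite expnMn leq_mul2l; apply/orP; right.
  apply: (@leq_trans (i ^ 2)); last by rewrite leq_pexp2l //; lia.
  by rewrite expnS expn1 leq_mul // leq_pred.
rewrite (eq_bigr (fun i => (fun i => - g i.-1) i.+1 - (fun i => - g i.-1) i)) => [|i _]; last first.
  by rewrite /= opprK addrC.
rewrite telescope_sumr //= opprK addrC gerBl.
by rewrite divr_ge0.
Qed.

Lemma mem_card_le (T : finType) (U : eqType) (A : {pred T}) (f : T -> U) (s : seq U) :
  {in A &, injective f} -> (forall t, t \in A -> f t \in s) -> (#|A| <= size s)%N.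
Proof.
move=> finj fs; rewrite cardE -(size_map f); apply: uniq_leq_size.
  by rewrite map_inj_in_uniq ?enum_uniq // => x y; rewrite !mem_enum; apply: finj.
by move=> u /mapP[t]; rewrite mem_enum => tA ->; apply: fs.
Qed.

(* Two polynomials of the family may be proportional. Those of content c inject into the boxes
   {1, ..., X / c}^(d+1), so summing over c >= T shows that at least half of the family has
   content less than T. *)
Theorem many_mahler d k q : (1 < d)%N -> (0 < k < d)%N -> (0 < q)%N ->
  exists2 C : nat, (0 < C)%N & forall N, (0 < N)%N -> exists V : seq algC,
   [/\ uniq V, (forall M, M \in V -> M <= (C * N)%:R /\ exists a, [/\ degA a = d, n_in_disk a = k & mahler a = M])
     & (N ^ (q * d.+1) <= C * size V ^ q * N)%N].
Proof.
move=> d1 kd q0; have [C C0 fam] := family_exists d1 kd.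
have [K fb] := fiber_bound d q0.
(* With X = C N, at most X^(d+1) / (T - 1) = N^(d+1) / 2 members of the family have content at least
   T. *)
pose T := (2 * C ^ d.+1).+1; have T1 : (1 < T)%N by rewrite /T ltnS muln_gt0 expn_gt0 C0.
exists (C + (2 * T) ^ q * K * C)%N => [|N N0]; first by rewrite addn_gt0 C0.
have [P [al [Pinj famP]]] := fam N N0.
pose F := {ffun 'I_d.+1 -> 'I_N}.
pose V := undup [seq mahler (al t) | t <- enum {: F}].
have VP M : M \in V -> exists t, M = mahler (al t).
  by rewrite mem_undup => /mapP[t _ ->]; exists t.
have VM t : mahler (al t) \in V by rewrite mem_undup; apply: (map_f (fun t => mahler (al t))); rewrite mem_enum.
exists V; split; first exact: undup_uniq.
  move=> M /VP[t ->]; have [[da nk mC _] _] := famP t; split; last by exists (al t).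
  by apply: le_trans mC _; rewrite ler_nat leq_mul2r leq_addr orbT.
have /choice[sM sMP] : forall M : algC, exists s : seq algC, 1 <= M ->
    ((size s) ^ q)%:R <= K%:R * M /\
    forall a, degA a = d -> mahler a = M -> (0 < #|outS d a| < d)%N -> good d a -> a \in s.
  move=> M; have [M1|M1] := pselect (1 <= M); last by exists [::] => /M1.
  by have [s s1 s2] := fb M M1; exists s.
pose B := \max_(M <- V) size (sM M).
have Bq : (B ^ q <= K * (C * N))%N.
  rewrite /B big_seq; elim/big_ind: _ => [|x y|M MV]; first by rewrite exp0n.
    by rewrite /maxn; case: ifP.
  have [t ME] := VP M MV; have M1 : 1 <= M by rewrite ME mahler_ge1.
  have [s1 _] := sMP M M1; rewrite -(ler_nat algC); apply: le_trans s1 _.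
  by rewrite natrM ler_wpM2l // ME; have [[]] := famP t.
have als t : al t \in sM (mahler (al t)).
  have [[da nk mC gd] _] := famP t; have [_ sP] := sMP _ (mahler_ge1 (al t)).
  by apply: sP => //; have := card_outS da; lia.
pose ct t := `|zcontents (P t)|%N.
have ctE t : zcontents (P t) = ct t by have [_ [c0 _ _ _]] := famP t; rewrite /ct gtz0_abs.
have ct0 t : (0 < ct t)%N by have [_ [c0 _ _ _]] := famP t; rewrite absz_gt0 gt_eqF.
(* A member is determined by its content and its root; the root lies in one of the fibers over V,
   each of size at most [B]. *)
have small : (#|[pred t | (ct t < T)%N]| <= T * (size V * B))%N.
  pose L := [seq (c, a) | c <- iota 0 T, a <- flatten [seq sM M | M <- V]].
  apply: (@leq_trans (size L)).
    apply: (mem_card_le (f := fun t => (ct t, al t))).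
      move=> t u _ _ [ctu atu]; apply: Pinj.
      by have [_ [_ -> _ _]] := famP t; have [_ [_ -> _ _]] := famP u; rewrite !ctE ctu atu.
    move=> t; rewrite inE => tT; apply/allpairsP; exists (ct t, al t); split=> //=.
      by rewrite -[_ :: _]/(iota 0 T) mem_iota.
    by apply/flattenP; exists (sM (mahler (al t))) => //; apply: map_f.
  rewrite size_allpairs size_iota leq_mul2l; apply/orP; right.
  rewrite -[X in (X * B)%N](size_map sM); apply: size_flatten_leq => s /mapP[M MV ->].
  by apply: (leq_bigmax_seq (F := fun M => size (sM M))).
pose X := (C * N)%N.
have ctX t : (ct t < X.+1)%N.
  have [_ [c0 E sz PX]] := famP t; have := PX ord0; rewrite E coefZ ctE => /andP[h1 h2].
  rewrite ltnS -lez_nat; apply: le_trans h2; rewrite ler_peMr //.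
  by rewrite ctE in c0; move: h1; rewrite (pmulr_rgt0 _ c0); lia.
have fibc c : (0 < c)%N -> (#|[pred t | ct t == c]| <= (X %/ c) ^ d.+1)%N.
  move=> c0; have c0' : 0 < c%:Z by lia.
  pose mc t (j : nat) : int := (minZpoly (al t))`_j.
  have mz t : ct t = c -> forall j : 'I_d.+1, (0 < `|mc t j| <= X %/ c)%N /\ 0 < mc t j.
    rewrite /mc => tc j; have [_ [_ E _ PX]] := famP t; have := PX j; rewrite E coefZ ctE tc pmulr_rgt0 // => /andP[h1 h2].
    split=> //; rewrite absz_gt0 gt_eqF //= leq_divRL // -lez_nat PoszM gtz0_abs // mulrC.
    exact: h2.
  pose G := {ffun 'I_d.+1 -> 'I_((X %/ c).+1)}.
  apply: (@leq_trans (size (enum [pred g : {ffun 'I_d.+1 -> 'I_((X %/ c).+1)} | [forall j, (0 < g j)%N]]))).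
    apply: (mem_card_le (f := fun t => [ffun j : 'I_d.+1 => inord `|mc t j|%N] : G)).
      move=> t u; rewrite !inE => /eqP tc /eqP uc /ffunP E; apply: Pinj.
      have [_ [_ Et st _]] := famP t; have [_ [_ Eu su _]] := famP u.
      apply/polyP => j; have [jd|jd] := ltnP j d.+1; last by rewrite !nth_default ?st ?su.
      rewrite Et Eu !coefZ !ctE tc uc; congr (_ * _).
      have [/andP[_ t1] t2] := mz t tc (Ordinal jd); have [/andP[_ u1] u2] := mz u uc (Ordinal jd).
      have := E (Ordinal jd); rewrite !ffunE => /(congr1 val); rewrite /= !inordK ?ltnS // => /(congr1 Posz).
      by rewrite /mc !gtz0_abs.
    move=> t; rewrite inE => /eqP tc; rewrite mem_enum inE; apply/forallP => j.
    by have [/andP[t0 t1] _] := mz t tc j; rewrite ffunE inordK.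
  rewrite -cardE (eq_card (B := ffun_on [pred i : 'I_((X %/ c).+1) | (0 < i)%N])); last first.
    move=> g; apply/idP/idP => [|/ffun_onP H]; rewrite inE.
      by [].
    by apply/forallP => j; have := H j; rewrite inE.
  rewrite card_ffun_on card_ord leq_expn2r // (eq_card (B := predC1 ord0)) ?cardC1 ?card_ord //.
  by move=> i; rewrite !inE -val_eqE /= lt0n.
have big : (2 * #|[pred t | (T <= ct t)%N]| <= N ^ d.+1)%N.
  have sumE : (#|[pred t | (T <= ct t)%N]| <= \sum_(T <= c < X.+1) (X %/ c) ^ d.+1)%N.
    rewrite -sum1_card (partition_big (fun t => Ordinal (ctX t)) (fun c : 'I_X.+1 => (T <= c)%N)) /=; last by [].
    rewrite -(big_mkord (fun c => (T <= c)%N) (fun c => \sum_(i | (T <= ct i)%N && (ct i == c)) 1)%N).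
    have [TX|TX] := leqP T X.+1; last first.
      by rewrite big_nat_cond big1 // => c /andP[/andP[_ cX] Tc]; lia.
    rewrite (big_cat_nat (n := T)) //= big_nat_cond big1 ?add0n => [|c /andP[/andP[_ cT] Tc]]; last by lia.
    apply: (@leq_trans (\sum_(T <= c < X.+1) #|[pred t | ct t == c]|)%N).
      rewrite [leqLHS]big_mkcond /=; apply: leq_sum => c _; case: ifP => // Tc.
      rewrite -sum1_card [leqLHS]big_mkcond [leqRHS]big_mkcond /=; apply: leq_sum => t _.
      by rewrite inE; case: (_ == _); rewrite ?andbF //; case: ifP.
    rewrite [leqLHS]big_seq_cond [leqRHS]big_seq_cond.
    apply: leq_sum => c /andP[]; rewrite mem_index_iota => /andP[Tc _] _; apply: fibc; lia.
  have := sum_div_pow_bound X d.-1 T1; rewrite (_ : d.-1.+2 = d.+1); last by lia.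
  rewrite -big_distrl /= => H.
  have {}H := leq_trans (leq_mul sumE (leqnn T.-1)) H.
  have C1 : (0 < C ^ d.+1)%N by rewrite expn_gt0 C0.
  rewrite -(leq_pmul2l C1) -expnMn; apply: leq_trans H; apply: eq_leq.
  by rewrite /T /=; ring.
have tot : (N ^ d.+1 <= 2 * T * size V * B)%N.
  have : (#|[pred t | (ct t < T)%N]| + #|[pred t | (T <= ct t)%N]| = N ^ d.+1)%N.
    have <- : #|{: F}| = (N ^ d.+1)%N by rewrite card_ffun !card_ord.
    rewrite -(cardC [pred t | (ct t < T)%N]); congr (_ + _)%N.
    by apply: eq_card => t; rewrite !inE -leqNgt.
  by move: small big; rewrite -!mulnA; lia.
rewrite mulnC expnM; apply: leq_trans (leq_expn2r q tot) _.
rewrite (_ : (2 * T * size V * B) ^ q = (2 * T) ^ q * size V ^ q * B ^ q)%N; last by rewrite !expnMn.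
apply: (@leq_trans ((2 * T) ^ q * size V ^ q * (K * (C * N))))%N.
  by rewrite leq_mul2l Bq orbT.
rewrite (_ : _ * _ * _ = (2 * T) ^ q * K * C * (size V ^ q * N))%N; last by ring.
by rewrite -[leqRHS]mulnA leq_mul2r leq_addl orbT.
Qed.

(** * Heights as real numbers *)

Section ToR.
Variable R : realType.

Let cut (x : algC) : set R := [set (ratr q : R) | q in [set q : rat | ratr q <= x]]%classic.

Lemma toR_cut_neq0 (x : algC) : 0 <= x -> (cut x !=set0)%classic.
Proof. by move=> x0; exists (ratr 0); exists 0 => //=; rewrite rmorph0. Qed.

Lemma toR_cut_bound (x : algC) (q : rat) : x <= ratr q -> ubound (cut x) (ratr q : R).
Proof.
by move=> xq _ [p /= px <-]; rewrite ler_rat -(ler_rat algC); apply: le_trans px xq.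
Qed.

Lemma rat_above (x : algC) : 0 <= x -> exists q : rat, x <= ratr q.
Proof.
by move=> x0; exists (Num.bound x)%:R; rewrite ratr_nat ltW // archi_boundP.
Qed.

Lemma toR_cut_sup (x : algC) : 0 <= x -> has_sup (cut x).
Proof.
move=> x0; split; first exact: toR_cut_neq0.
by have [q xq] := rat_above x0; exists (ratr q); apply: toR_cut_bound.
Qed.

Lemma toR_ge (x : algC) (q : rat) : 0 <= x -> ratr q <= x -> ratr q <= toR R x.
Proof.
by move=> x0 qx; apply: (ub_le_sup (toR_cut_sup x0).2); exists q.
Qed.

Lemma toR_le (x : algC) (q : rat) : 0 <= x -> x <= ratr q -> toR R x <= ratr q.
Proof. by move=> x0 xq; apply: ge_sup (toR_cut_neq0 x0) (toR_cut_bound xq). Qed.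

(** Two rationals q1 < q2 are put between x and y, with a denominator n such that n (y - x) > 2: a
    single one would only give a weak inequality. *)
Lemma toR_lt (x y : algC) : 0 <= x -> x < y -> toR R x < toR R y.
Proof.
move=> x0 xy; have y0 : 0 <= y by apply: le_trans (ltW xy).
have e0 : 0 < y - x by rewrite subr_gt0.
have z0 : 0 <= 2%:R / (y - x) by rewrite divr_ge0 // ltW.
set n := Num.bound (2%:R / (y - x)).
have nP : 2%:R < n%:R * (y - x) by rewrite -ltr_pdivrMr // archi_boundP.
have n0 : 0 < n%:R :> algC by rewrite -(pmulr_lgt0 _ e0); apply: lt_trans nP.
have nr : 0 < n%:R :> rat by rewrite ltr0n -(ltr0n algC).
have nx0 : 0 <= n%:R * x by rewrite mulr_ge0 // ltW.
have nxr : n%:R * x \is Num.real by rewrite ger0_real.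
set m := Num.floor (n%:R * x).
have m1 : m%:~R <= n%:R * x by apply: real_floor_le.
have m2 : n%:R * x < (m + 1)%:~R by apply: real_floorD1_gt.
pose q1 : rat := (m + 1)%:~R / n%:R; pose q2 : rat := (m + 2)%:~R / n%:R.
apply: (@le_lt_trans _ _ (ratr q1)).
  apply: toR_le => //; rewrite /q1 fmorph_div /= ratr_int ratr_nat ler_pdivlMr //.
  by rewrite mulrC ltW.
apply: (@lt_le_trans _ _ (ratr q2)).
  by rewrite ltr_rat /q1 /q2 ltr_pM2r ?invr_gt0 // ltr_int; lia.
apply: toR_ge => //; rewrite /q2 fmorph_div /= ratr_int ratr_nat ler_pdivrMr //.
rewrite intrD; apply: (@le_trans _ _ (n%:R * x + 2%:R)); first by rewrite lerD2r.
by rewrite -lerBrDl [y * _]mulrC -mulrBr ltW.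
Qed.

Lemma toR_inj (x y : algC) : 0 <= x -> 0 <= y -> toR R x = toR R y -> x = y.
Proof.
move=> x0 y0 E; have [xy|yx|//] := real_ltgtP (ger0_real x0) (ger0_real y0).
  by have := toR_lt x0 xy; rewrite E ltxx.
by have := toR_lt y0 yx; rewrite E ltxx.
Qed.

Lemma toR_nat (n : nat) (c : nat) (x : algC) : 0 <= x -> (0 < c)%N ->
  n%:R <= c%:R * x -> n%:R <= c%:R * toR R x.
Proof.
move=> x0 c0 nx; have cr : 0 < c%:R :> R by rewrite ltr0n.
have := @toR_ge x (n%:R / c%:R) x0.
rewrite !fmorph_div /= !ratr_nat ler_pdivrMr ?ltr0n // [x * _]mulrC => /(_ nx).
by rewrite ler_pdivrMr // mulrC.
Qed.

Lemma toR_le_nat (n : nat) (x : algC) : 0 <= x -> x <= n%:R -> toR R x <= n%:R.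
Proof.
by move=> x0 xn; have := @toR_le x n%:R x0; rewrite !ratr_nat; apply.
Qed.

Lemma toR_mahler_ge1 (a : algC) : 1 <= toR R (mahler a).
Proof.
have M1 := mahler_ge1 a; have := @toR_ge (mahler a) 1 (le_trans ler01 M1).
by rewrite !rmorph1; apply.
Qed.

Lemma height_pow d (a : algC) : degA a = d -> height R a ^+ d = toR R (mahler a).
Proof.
move=> da; have d0 : (0 < d)%N by rewrite -da degA_gt0.
rewrite /height da -powR_mulrn ?powR_ge0 // -powRrM mulVf ?pnatr_eq0 -?lt0n //.
by rewrite powRr1 // (le_trans ler01) ?toR_mahler_ge1.
Qed.

Lemma height_ge1 (a : algC) : 1 <= height R a.
Proof.
have := toR_mahler_ge1 a; rewrite -(height_pow (erefl (degA a))) => h.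
by rewrite -(@expr_ge1 _ (degA a)) ?degA_gt0 ?powR_ge0.
Qed.

Lemma height_inj d (a b : algC) : degA a = d -> degA b = d -> height R a = height R b -> mahler a = mahler b.
Proof.
move=> da db E; apply: toR_inj; rewrite ?(le_trans ler01) ?mahler_ge1 //.
by rewrite -(height_pow da) -(height_pow db) E.
Qed.

End ToR.

(** * Counting heights up to a bound *)

Lemma card_set_le (T : choiceType) (A : set T) (s : seq T) :
  (forall x, A x -> x \in s) -> finite_set A /\ (card_set T A <= size s)%N.
Proof.
(* Finiteness is returned too, because [fset_set], hence [card_set], reflects a set only when it is
   finite. *)
move=> As; have fA : finite_set A by apply: sub_finite_set (finite_seq s) => x /As.
split=> //; rewrite /card_set; apply: uniq_leq_size; first exact: finmap.fset_uniq.
by move=> x; rewrite in_fset_set // => /set_mem/As.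
Qed.

Lemma card_set_ge (T : choiceType) (A : set T) (s : seq T) : finite_set A -> uniq s ->
  (forall x, x \in s -> A x) -> (size s <= card_set T A)%N.
Proof.
move=> fA us sA; rewrite /card_set; apply: uniq_leq_size => // x xs.
by rewrite in_fset_set //; apply/mem_set/sA.
Qed.

(** Multiplying by X - z enlarges the maximal coefficient by at most 1 + |z| <= 2 max(1, |z|). *)
Lemma coef_prod_XsubC_bound (s : seq algC) j :
  `|(\prod_(z <- s) ('X - z%:P))`_j| <= 2 ^+ size s * \prod_(z <- s) Num.max 1 `|z|.
Proof.
elim: s j => [|z s IH] j.
  rewrite !big_nil expr0 mulr1 coefC; case: (j == 0)%N; by rewrite ?normr1 ?normr0.
have m1 : 1 <= Num.max 1 `|z| /\ `|z| <= Num.max 1 `|z|.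
  by rewrite /Order.max; case: (real_ltP (real1 algC) (normr_real z)) => h; split=> //; apply: ltW.
rewrite !big_cons mulrBl coefB ['X * _]mulrC coefMX coefCM /=.
set m := Num.max 1 _ in m1 *; set X := 2 ^+ size s * _ in IH.
have X0 : 0 <= X by apply: le_trans (IH 0%N).
have -> : 2 ^+ (size s).+1 * (m * \prod_(z0 <- s) Num.max 1 `|z0|) = m * X + m * X.
  by rewrite /X exprS; ring.
apply: le_trans (ler_normB _ _) _; apply: lerD.
  apply: (@le_trans _ _ X); last by rewrite ler_peMl ?m1.1.
  by case: eqP; rewrite ?normr0 ?IH.
by rewrite normrM ler_pM // m1.2.
Qed.

Lemma coef_minZpoly_bound d (a : algC) j : degA a = d ->
  (absz (minZpoly a)`_j)%:R <= (2 ^ d)%:R * mahler a.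
Proof.
move=> da; have [l0 E _] := minZpoly_spec a.
have := congr1 (fun q : {poly algC} => q`_j) E; rewrite coef_map coefZ conjsE /= => Ej.
rewrite natr_absz intr_norm Ej normrM ger0_norm ?ler0z ?(ltW l0) //.
rewrite /mahler mulrCA ler_wpM2l ?ler0z ?(ltW l0) //.
by have := coef_prod_XsubC_bound (conjs a) j; rewrite size_conjs da natrX.
Qed.

Lemma size_minZpoly (a : algC) : size (minZpoly a) = (degA a).+1.
Proof.
have [l0 E _] := minZpoly_spec a.
rewrite -(size_map_inj_poly (f := intr : int -> algC)) ?E //; last exact: intr_inj.
rewrite size_scale ?intr_eq0 ?gt_eqF // /degA prednK //.
by apply: ltnW (size_minCpoly a).
Qed.

Lemma heights_finite (R : realType) d : (0 < d)%N -> exists2 C : nat, (0 < C)%N &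
  forall (k : nat) (H : R), 1 <= H -> exists2 s : seq R, forall x, Bupto R k d H x -> x \in s &
    (size s)%:R <= C%:R * H ^+ (d * d.+1).
Proof.
(* Coefficients lie in [-b, b] with b <= X = 2^d H^d, so each takes at most 2 b + 1 <= 4 X = 2^(d+2)
   H^d values; each polynomial has at most d roots. *)
move=> d0; exists (d * (2 ^ d.+2) ^ d.+1)%N => [|k H H1]; first by rewrite muln_gt0 d0 !expn_gt0.
have H0 : 0 <= H by apply: le_trans H1.
pose X : R := (2 ^ d)%:R * H ^+ d.
have X1 : 1 <= X by rewrite mulr_ege1 ?exprn_ege1 // -[1]/(1%:R) ler_nat expn_gt0.
have X0 : 0 <= X by apply: le_trans X1.
pose b := Num.truncn X.
have bX : b%:R <= X by rewrite truncn_le.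
pose T := {ffun 'I_d.+1 -> 'I_(2 * b).+1}.
pose Q (f : T) : {poly algC} := \poly_(j < d.+1) ((f (inord j))%:R - b%:R).
pose rts f := sval (closed_field_poly_normal (Q f)).
exists [seq height R a | a <- flatten [seq rts f | f <- enum {: T} & Q f != 0]].
  move=> x [[a [H' [_ [da [_ nk]]]] xE] /= /andP[x1 xH]].
  rewrite -xE; apply: map_f.
  have M0 : 0 <= mahler a by apply: le_trans (mahler_ge1 a).
  pose c j : int := (minZpoly a)`_j.
  have cb j : (`|c j| <= b)%N.
    rewrite truncn_ge_nat // -/X.
    apply: le_trans (toR_nat R M0 _ (coef_minZpoly_bound j da)) _; first by rewrite expn_gt0.
    by rewrite /X -(height_pow R da) xE ler_wpM2l // lerXn2r ?nnegrE // (le_trans ler01).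
  pose f : T := [ffun j : 'I_d.+1 => inord `|(c j + b%:Z)%R|%N].
  have cb0 j : 0 <= c j + b%:Z by have := cb j; lia.
  have fE (j : 'I_d.+1) : (f j : nat)%:Z = c j + b%:Z.
    by rewrite ffunE inordK ?gez0_abs // ltnS; have := cb j; lia.
  have QE : Q f = map_poly intr (minZpoly a).
    apply/polyP => j; rewrite coef_poly coef_map /=; case: ltnP => jd; last first.
      by rewrite nth_default ?size_minZpoly ?da.
    have := congr1 (fun z : int => z%:~R : algC) (fE (inord j)); rewrite /= -pmulrn => ->.
    by rewrite inordK // rmorphD /= -pmulrn addrK.
  have Q0 : Q f != 0.
    rewrite QE map_poly_eq0_id0 ?intr_eq0 ?lead_coef_eq0 -size_poly_eq0 size_minZpoly //.
  apply/flattenP; exists (rts f); first by apply: map_f; rewrite mem_filter Q0 mem_enum.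
  rewrite /rts; case: closed_field_poly_normal => rs /= E.
  have : root (Q f) a.
    have [l0 E2 _] := minZpoly_spec a.
    by rewrite QE E2 rootZ ?intr_eq0 ?gt_eqF // root_minCpoly.
  by rewrite E rootZ ?lead_coef_eq0 // root_prod_XsubC.
rewrite size_map; set s := flatten _.
have sz : (size s <= (2 * b).+1 ^ d.+1 * d)%N.
  apply: leq_trans (size_flatten_leq (m := d) _) _.
    move=> t /mapP[f]; rewrite mem_filter => /andP[Q0 _] ->.
    rewrite /rts; case: closed_field_poly_normal => rs /= E.
    rewrite -ltnS -(size_prod_XsubC rs id) -(size_scale _ (_ : lead_coef (Q f) != 0)) ?lead_coef_eq0 // -E.
    exact: size_poly.
  rewrite leq_mul2r; apply/orP; right; rewrite size_map size_filter.
  by apply: leq_trans (count_size _ _) _; rewrite -cardE card_ffun !card_ord.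
apply: (@le_trans _ _ ((2 * b).+1 ^ d.+1 * d)%:R); first by rewrite ler_nat.
rewrite natrM mulrC [in leRHS]natrM -mulrA ler_wpM2l // exprM natrX [(_ ^ d.+1)%:R]natrX -exprMn.
rewrite lerXn2r ?nnegrE ?mulr_ge0 ?exprn_ge0 //.
apply: (@le_trans _ _ (2%:R * X + 2%:R * X)); last by rewrite /X !natrX !exprS; lra.
by rewrite -natr1 natrM; apply: lerD; [rewrite ler_wpM2l|lra].
Qed.

Lemma BsetP (R : realType) k d (x : R) :
  Bset R k d x <-> exists a, [/\ degA a = d, n_in_disk a = k & height R a = x].
Proof.
split=> [[a [H [_ [da [_ na]]]] ax]|[a [da na ax]]]; first by exists a.
by exists a => //; exists (height R a); split; [exact: height_ge1|].
Qed.

Lemma many_heights (R : realType) d k q : (1 < d)%N -> (0 < k < d)%N -> (0 < q)%N ->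
  exists2 C : nat, (0 < C)%N & forall N (H : R), (0 < N)%N -> 1 <= H -> (C * N)%:R <= H ^+ d ->
  exists V : seq R, [/\ uniq V, forall x, x \in V -> Bupto R k d H x
     & (N ^ (q * d.+1) <= C * size V ^ q * N)%N].
Proof.
move=> d1 kd q0; have [C C0 CP] := many_mahler d1 kd q0; exists C => // N H N0 H1 NH.
have H0 : 0 <= H by apply: le_trans H1.
have d0 : (0 < d)%N by apply: ltnW.
have [V [Vu VP VN]] := CP N N0.
have /choice[f fP] : forall M : algC, exists a, M \in V -> [/\ degA a = d, n_in_disk a = k & mahler a = M].
  move=> M; have [/VP[_ [a aP]]|_] := boolP (M \in V); first by exists a.
  by exists 0.
exists [seq height R (f M) | M <- V]; split; last by rewrite size_map.
  rewrite map_inj_in_uniq // => M M' MV MV' E.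
  have [da _ <-] := fP M MV; have [da' _ <-] := fP M' MV'.
  exact: (height_inj da da' E).
move=> x /mapP[M MV ->]; have [da na ma] := fP M MV; split.
  by apply/BsetP; exists (f M).
rewrite /= height_ge1 /= -(@ler_pXn2r _ d) ?nnegrE ?powR_ge0 //.
rewrite (height_pow R da) ma; apply: le_trans NH; apply: toR_le_nat.
  by rewrite -ma (le_trans ler01) ?mahler_ge1.
by have [] := VP M MV.
Qed.

(** Bounded heights would form a finite set, contained in a list [s], whereas the lower bound with q
    = 1 gives at least N^d / C of them for every N; N = C |s| + 1 is a contradiction. *)
Lemma Bset_unbounded (R : realType) d k (M : R) : (1 < d)%N -> (0 < k < d)%N ->
  exists x, Bset R k d x /\ M < x.
Proof.
move=> d1 kd; have d0 : (0 < d)%N by apply: ltnW.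
apply: contrapT => none.
have B_le x : Bset R k d x -> x <= M.
  by move=> Bx; rewrite leNgt; apply/negP => Mx; apply: none; exists x.
have [C1 _ fin] := heights_finite R d0.
pose H0 := Num.max 1 M.
have H01 : 1 <= H0 by rewrite le_max lexx.
have [s sP _] := fin k H0 H01.
have [C C0 CP] := many_heights R d1 kd (isT : (0 < 1)%N).
pose N := (C * size s).+1.
pose H := Num.max 1 ((C * N)%:R : R).
have H1 : 1 <= H by rewrite le_max lexx.
have [|V [Vu VP VN]] := CP N H isT H1.
  apply: (@le_trans _ _ H); first by rewrite le_max lexx orbT.
  by rewrite ler_eXnr.
have Vs : (size V <= size s)%N.
  apply: uniq_leq_size => // x /VP[Bx _]; apply: sP; split=> //=.
  have [a [_ _ E]] := (BsetP k d x).1 Bx.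
  by rewrite -{1}E height_ge1 /= le_max B_le ?orbT.
move: VN; rewrite mul1n expn1 expnSr leq_pmul2r // => VN.
have : (N <= C * size s)%N.
  apply: leq_trans (_ : C * size V <= _)%N; last by rewrite leq_mul2l Vs orbT.
  by apply: leq_trans VN; rewrite -[X in (X <= _)%N]expn1 leq_pexp2l.
by rewrite ltnn.
Qed.

(** * The limits a(k,d) and b(k,d) *)

Theorem a_lim_of_good (R : realType) d k : (1 < d)%N -> (0 < k < d)%N ->
  (forall a, degA a = d -> n_in_disk a = k -> good d a) -> a_lim R k d 0.
Proof.
move=> d1 kd gd; split=> [M|e e0]; first exact: Bset_unbounded.
have d0 : (0 < d)%N by apply: ltnW.
(* The fiber bound gives n^q <= (K + 1) x^d, which is at most x^(d+1) beyond the threshold; so ln n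
   / ln x <= (d + 1) / q < e. *)
pose q := (Num.bound (d.+1%:R / e)).+1.
have qe : d.+1%:R < q%:R * e.
  rewrite -ltr_pdivrMr //; apply: lt_trans (archi_boundP _) _; first by rewrite divr_ge0 // ltW.
  by rewrite ltr_nat.
have [K fb] := fiber_bound d (isT : (0 < q)%N).
exists (1 + K.+1%:R) => x /BsetP[a [da na ax]] Kx.
have K1 : 1 <= K.+1%:R :> R by rewrite -[1]/(1%:R) ler_nat.
have x1 : 1 < x by apply: le_lt_trans Kx; rewrite lerDl.
have x0 : 0 < x by apply: lt_trans x1.
have Lx : 0 < ln x by rewrite ln_gt0.
have [s sK sP] := fb (mahler a) (mahler_ge1 a).
have As b : Aset R k d x b -> b \in s.
  move=> [db [bx nb]]; apply: sP => //; last exact: gd.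
    by apply: (height_inj (R := R) db da); rewrite bx ax.
  by have := card_outS db; rewrite nb; lia.
have [fA] := card_set_le As; set n := card_set _ _ => ns.
have n1 : (0 < n)%N.
  have := @card_set_ge _ (Aset R k d x) [:: a] fA isT; apply => b.
  by rewrite inE => /eqP ->.
have nR : 0 < n%:R :> R by rewrite ltr0n.
rewrite subr0 ger0_norm; last by rewrite divr_ge0 ?(ltW Lx) // ln_ge0 // -[1]/(1%:R) ler_nat.
rewrite ltr_pdivrMr //.
have nq : n%:R ^+ q <= K.+1%:R * x ^+ d.
  rewrite -natrX -ax (height_pow R da); apply: (@le_trans _ _ (size s ^ q)%:R).
    by rewrite ler_nat leq_expn2r.
  apply: toR_nat => //; first by rewrite (le_trans ler01) ?mahler_ge1.
  apply: le_trans sK _; rewrite ler_wpM2r ?(le_trans ler01) ?mahler_ge1 //.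
  by rewrite ler_nat.
have : ln (n%:R ^+ q) <= ln (K.+1%:R * x ^+ d) :> R.
  by rewrite ler_ln ?posrE ?exprn_gt0 ?mulr_gt0 ?exprn_gt0.
rewrite lnM ?posrE ?exprn_gt0 // !lnXn // => h.
have : ln K.+1%:R <= ln x :> R.
  by rewrite ler_ln ?posrE // ltW // (le_lt_trans _ Kx) // lerDr.
move=> h2.
have : ln n%:R *+ q < (e * ln x) *+ q.
  apply: (@le_lt_trans _ _ (ln x *+ d.+1)); first by apply: le_trans h _; rewrite [leRHS]mulrS lerD2r.
  by rewrite -[ltLHS]mulr_natl -[ltRHS]mulr_natl mulrA ltr_pM2r.
by rewrite ltr_pMn2r.
Qed.

(** Above, the count is O(x^(d (d + 1))). Below, N close to x^d / C gives at least a constant times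
    N^(d + 1 - 1/q) heights; the loss d / q in the exponent is less than e / 2. *)
Theorem b_lim_value (R : realType) d k : (1 < d)%N -> (0 < k < d)%N -> b_lim R k d (d * (d + 1))%:R.
Proof.
move=> d1 kd; split=> [M|e e0].
  by exists (M + 1); split=> //; rewrite ltrDl.
have d0 : (0 < d)%N by apply: ltnW.
pose q := (Num.bound ((2 * d)%:R / e)).+1.
have qe : (2 * d)%:R < q%:R * e.
  rewrite -ltr_pdivrMr //; apply: lt_trans (archi_boundP _) _; first by rewrite divr_ge0 // ltW.
  by rewrite ltr_nat.
have [C1 C10 fin] := heights_finite R d0.
have [C C0 CP] := many_heights R d1 kd (isT : (0 < q)%N).
have CR : 0 < C%:R :> R by rewrite ltr0n.
have C1R : 0 < C1%:R :> R by rewrite ltr0n.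
pose c : R := ln (2 * C)%:R; pose c' : R := ln C%:R; pose c1 : R := ln C1%:R.
have c0 : 0 <= c by rewrite ln_ge0 // -[1]/(1%:R) ler_nat; lia.
have c'0 : 0 <= c' by rewrite ln_ge0 // -[1]/(1%:R) ler_nat; lia.
have c10 : 0 <= c1 by rewrite ln_ge0 // -[1]/(1%:R) ler_nat; lia.
pose c3 := d.+1%:R * c + c' + c1.
have c30 : 0 <= c3 by rewrite !addr_ge0 ?mulr_ge0.
(* Beyond this threshold the accumulated constants [c3] stay below (e / 2) ln x. *)
exists (1 + C%:R + expR (2%:R * c3 / e)) => x _ Mx.
have ex0 : 0 < expR (2%:R * c3 / e) :> R by apply: expR_gt0.
have x1 : 1 < x by lra.
have xC : C%:R <= x by lra.
have x0 : 0 < x by apply: lt_trans x1.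
have xe : expR (2%:R * c3 / e) < x by lra.
set L := ln x.
have L0 : 0 < L by rewrite ln_gt0.
have Lc : 2%:R * c3 < e * L.
  rewrite -ltr_pdivrMl // mulrC -[ltLHS]expRK.
  by rewrite ltr_ln ?posrE.
have [s sP sz] := fin k x (ltW x1).
have [fB] := card_set_le sP; set n := card_set _ _ => ns.
pose N := Num.truncn (x ^+ d / C%:R).
have xd : x <= x ^+ d by rewrite ler_eXnr // ltW.
have xdC : 1 <= x ^+ d / C%:R by rewrite ler_pdivlMr // mul1r (le_trans xC).
have xdC0 : 0 <= x ^+ d / C%:R by apply: le_trans xdC.
have N0 : (0 < N)%N by rewrite truncn_gt0.
have NR : 0 < N%:R :> R by rewrite ltr0n.
have [|V [Vu VP VN]] := CP N x N0 (ltW x1).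
  by rewrite natrM mulrC -ler_pdivlMr // truncn_le.
have Vn : (size V <= n)%N by apply: card_set_ge.
have n0 : (0 < n)%N.
  apply: leq_trans Vn; case: (size V) VN => // VN; exfalso.
  by move: VN; rewrite exp0n // muln0 mul0n leqn0 expn_eq0 -leqn0 leqNgt N0.
have nR : 0 < n%:R :> R by rewrite ltr0n.
have up : ln n%:R <= c1 + L *+ (d * d.+1).
  rewrite /c1 /L -lnXn // -lnM ?posrE ?exprn_gt0 // ler_ln ?posrE ?mulr_gt0 ?exprn_gt0 //.
  by apply: le_trans sz; rewrite ler_nat.
(* Truncation loses at most a factor 2, whence 2 C in the definition of [c]. *)
have lowN : L *+ d - c <= ln N%:R.
  rewrite /c /L -lnXn // -ln_div ?posrE ?exprn_gt0 ?ltr0n ?muln_gt0 //.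
  rewrite ler_ln ?posrE ?divr_gt0 ?exprn_gt0 ?ltr0n ?muln_gt0 //.
  rewrite ler_pdivrMr ?ltr0n ?muln_gt0 // natrM mulrCA -ler_pdivrMl // mulrC.
  have := truncnS_gt (x ^+ d / C%:R); rewrite -/N -natr1 => h.
  rewrite ltr_pdivrMr // mulrDl mul1r in h.
  have : C%:R <= N%:R * C%:R :> R by rewrite ler_peMl ?(ltW CR) // -[1]/(1%:R) ler_nat.
  lra.
(* The exponent drops by one because the extra factor N on the right of [VN] is cancelled. *)
have VN' : (N ^ (q * d.+1).-1 <= C * n ^ q)%N.
  rewrite -(leq_pmul2r N0) -expnSr prednK ?muln_gt0 //.
  by apply: leq_trans VN _; rewrite leq_mul2r leq_mul2l leq_expn2r ?orbT.
have low : ln N%:R *+ (q * d.+1).-1 <= c' + ln n%:R *+ q.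
  have h : N%:R ^+ (q * d.+1).-1 <= C%:R * n%:R ^+ q :> R.
    by rewrite -[N%:R ^+ _]natrX -[n%:R ^+ _]natrX -natrM ler_nat.
  rewrite /c' -(lnXn _ NR) -(lnXn _ nR) -lnM ?posrE ?exprn_gt0 //.
  have N'0 : 0 < N%:R ^+ (q * d.+1).-1 :> R by exact: exprn_gt0.
  have n'0 : 0 < C%:R * n%:R ^+ q :> R by rewrite mulr_gt0 // exprn_gt0.
  by rewrite ler_ln ?posrE.
have E : (d * (d + 1))%:R = d%:R * (d%:R + 1) :> R by rewrite natrM natrD.
have qR : 0 < q%:R :> R by rewrite ltr0n.
have up' : ln n%:R <= c1 + d%:R * (d%:R + 1) * L.
  by move: up; rewrite -(mulr_natl L) natrM -natr1.
have low' : d%:R * (d%:R + 1) * L - d%:R / q%:R * L - (d%:R + 1) * c - c' <= ln n%:R.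
  rewrite -(ler_pM2l qR).
  have h1 : (q%:R * (d%:R + 1) - 1) * (d%:R * L - c) <= c' + q%:R * ln n%:R.
    apply: le_trans (_ : (q%:R * (d%:R + 1) - 1) * ln N%:R <= _).
      rewrite ler_wpM2l; first by [].
        by rewrite subr_ge0 natr1 -natrM -[1]/(1%:R) ler_nat muln_gt0.
      by move: lowN; rewrite -(mulr_natl L).
    move: low; rewrite -(mulr_natl (ln N%:R)) -(mulr_natl (ln n%:R)).
    have -> : (q * d.+1).-1%:R = q%:R * (d%:R + 1) - 1 :> R.
      by rewrite natr1 -natrM -[X in _ = X%:R - _](@prednK (q * d.+1)) ?muln_gt0 // -natr1 addrK.
    by [].
  have q1 : 1 <= q%:R :> R by rewrite -[1]/(1%:R) ler_nat.
  have h2 : c' <= q%:R * c' by rewrite ler_peMl.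
  have -> : q%:R * (d%:R * (d%:R + 1) * L - d%:R / q%:R * L - (d%:R + 1) * c - c')
     = q%:R * (d%:R * (d%:R + 1) * L) - d%:R * L - q%:R * ((d%:R + 1) * c) - q%:R * c'.
    by field; rewrite gt_eqF.
  have E1 : (q%:R * (d%:R + 1) - 1) * (d%:R * L - c)
     = q%:R * (d%:R * (d%:R + 1) * L) - d%:R * L - q%:R * ((d%:R + 1) * c) + c by ring.
  rewrite E1 in h1; lra.
have dq : d%:R / q%:R * L < e / 2%:R * L.
  rewrite ltr_pM2r // ltr_pdivrMr //; move: qe; rewrite natrM; lra.
have d1E : d.+1%:R = d%:R + 1 :> R by rewrite -natr1.
have Lc' : 2%:R * ((d%:R + 1) * c + c' + c1) < e * L by move: Lc; rewrite /c3 d1E.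
have dc0 : 0 <= (d%:R + 1) * c by rewrite mulr_ge0 // addr_ge0.
set D := d%:R * (d%:R + 1) in E low' up' *.
rewrite E ltr_norml; apply/andP; split.
  rewrite ltrBrDl ltr_pdivlMr // mulrDl mulNr; lra.
rewrite ltrBlDl ltr_pdivrMr // mulrDl; lra.
Qed.

Theorem theorem4p1 (R : realType) (d k : nat) (hk : (k <= d)%N) :
  ((2 <= d)%N -> a_lim R 1 d 0 /\ a_lim R (d - 1) d 0) /\
  ((2 <= d)%N -> (0 < k < d)%N -> b_lim R k d ((d * (d + 1))%:R)) /\
  (prime d -> (0 < k < d)%N -> a_lim R k d 0).
Proof.
have tr (a : algC) : degA a = d -> forall i j, exists2 s : 'S_d, s \in galR (root_of d a) & s i = j.
  by move=> da i j; apply: galR_trans.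
split; [|split].
(* For k = 1 all conjugates but one are outside the disk; for k = d - 1 exactly one is. *)
- move=> d2; split; apply: a_lim_of_good => [||a da na]; try lia.
    by apply: spans_cosingleton (tr a da) d2 _; have := card_outS da; rewrite na; lia.
  by apply: spans_singleton (tr a da) _; have := card_outS da; rewrite na; lia.
- by move=> d2 kd; apply: b_lim_value.
- move=> pd kd; apply: (a_lim_of_good _ (prime_gt1 pd) kd) => a da na.
  apply: (@spans_prime _ (galR_group (root_of d a)) _ pd (tr a da)).
  by have := card_outS da; rewrite na; lia.
Qed.
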